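(* Let $\Pi_1$ contain only the uniform distribution on $[2n]$, and let $\Pi_2$ be the set of distributions on $[2n]$ whose total variation distance from the uniform distribution is more than $\epsilon$. Then every $(\Pi_1,\Pi_2,51/100)$-distribution tester under the parity trace has sample complexity at least $\widetilde\Omega\left(\left(\frac{n}{\epsilon}\right)^{4/5}+\frac{\sqrt n}{\epsilon^2}\right)$, where $\widetilde\Omega$ hides only polylogarithmic factors in $n$. Furthermore, this bound holds even for testers that are only required to be correct on inputs $\pi$ that place mass exactly $\frac{1}{2n}$ on each even element $2,4,\dots,2n$ (i.e. with $\Pi_2$ replaced by its subset of such distributions).
   Context: For a multiset $S\subset\mathbb N$ of size $m$ with sorted elements $x_1\le\dots\le x_m$, $\mathrm{trace}(S)=(x_1\bmod 2,\dots,x_m\bmod 2)$. $\mathrm{samp}(\pi,m)$ is the distribution of the multiset of $m$ i.i.d. samples from $\pi$. A $(\Pi_1,\Pi_2,\alpha)$-distribution tester under the parity trace with sample complexity $m$ is an algorithm receiving only $\mathrm{trace}(S)$, $S\sim\mathrm{samp}(\pi,m)$, that accepts with probability $\ge\alpha$ if $\pi\in\Pi_1$ and rejects with probability $\ge\alpha$ if $\pi\in\Pi_2$.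
   Formalization: The bound is stated for n at least 2 and 0 < ε < 1/4; for larger ε the class of far distributions with mass 1/(2n) on each even element can be empty (already at n = 2, ε = 1/4), so the claim without a bound on ε is false. *)

(* Defs.v *)
From HB Require Import structures.
From mathcomp Require Import all_boot all_order all_algebra.
From mathcomp Require Import finmap multiset.
From mathcomp Require Import classical_sets reals exp.

Set Implicit Arguments.
Unset Strict Implicit.
Unset Printing Implicit Defensive.

Import Order.TTheory GRing.Theory Num.Theory.

Local Open Scope mset_scope.
Local Open Scope classical_set_scope.
Local Open Scope ring_scope.

(* [true] is the residue 1; multiplicities are kept by [enum_mset]. *)
Definition trace (S : {mset nat}) : seq bool :=
  [seq odd x | x <- sort leq (enum_mset S)].

(* A distribution on [N] = {1, ..., N} is given by its mass function on 'I_N,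
   where the ordinal i stands for the element i + 1. *)
Definition elt (N : nat) (i : 'I_N) : nat := i.+1.

Definition is_dist (R : realType) (N : nat) (p : 'I_N -> R) : Prop :=
  (forall i, 0 <= p i) /\ \sum_i p i = 1.

Definition unif (R : realType) (N : nat) : 'I_N -> R := fun=> N%:R^-1.

Definition tv (R : realType) (N : nat) (p q : 'I_N -> R) : R :=
  2^-1 * \sum_i `|p i - q i|.

(* Expectation of f S for S ~ samp(p, m): the sum ranges over all ordered
   m-tuples of independent draws from p, and f sees only their multiset. *)
Definition samp_expect (R : realType) (N : nat) (p : 'I_N -> R) (m : nat)
    (f : {mset nat} -> R) : R :=
  \sum_(t : m.-tuple 'I_N)
    (\prod_(j < m) p (tnth t j)) * f (seq_mset [seq elt i | i <- t]).

(* Testers may be randomized: A w is the probability of accepting the trace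
   w. *)
Definition is_tester (R : realType) (N : nat) (Pi1 Pi2 : set ('I_N -> R))
    (alpha : R) (m : nat) (A : seq bool -> R) : Prop :=
  [/\ forall w, 0 <= A w <= 1,
      forall p, Pi1 p -> alpha <= samp_expect p m (fun S => A (trace S))
    & forall p, Pi2 p -> alpha <= samp_expect p m (fun S => 1 - A (trace S))].

Definition far_from_unif (R : realType) (N : nat) (eps : R) :
    set ('I_N -> R) :=
  [set p | is_dist p /\ eps < tv p (@unif R N)].

Definition unif_on_evens (R : realType) (N : nat) : set ('I_N -> R) :=
  [set p | forall i, ~~ odd (elt i) -> p i = N%:R^-1].

(* Main.v *)
Require Import Defs.
From HB Require Import structures.
From mathcomp Require Import all_boot all_order all_algebra.
From mathcomp Require Import finmap multiset.
From mathcomp Require Import classical_sets reals sequences exp.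
From mathcomp Require Import ring lra zify.

(* The odd elements are cut into blocks of q; in each block an independent,
   uniformly random odd element is made heavier at the expense of the others,
   by a relative amount th of order eps.

   For sqrt n / eps^2, compare second moments: the averaged likelihood ratio of
   the samples against the uniform distribution has second moment
   1 + O(m^2 th^4 / n).

   For (n / eps)^(4/5), write X_1, X_0 for two noncommuting variables. The trace
   of m samples with weights a_i has probability proportional to the coefficient
   of the corresponding word in the product over i of exp (a_i X_(parity of i)).
   Averaging the perturbation of one block changes no coefficient of words of
   length at most 2, because there only linear terms in the weights and the
   square of the total odd weight of the block occur. Reveal the trace of each
   superblock of B consecutive blocks: a superblock trace of length k changes its
   probability only by a relative O(30^k th^2 / B^2), as three samples have to
   fall into one block. If m B = O(n) the superblock lengths have bounded
   exponential moments, so the squared distance is O((n / B) th^4 / B^4), which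
   is small for B of order (n th^4)^(1/5). Hence m B exceeds a multiple of n,
   that is, m is at least of order (n / eps)^(4/5), without logarithms. *)

Set Implicit Arguments.
Unset Strict Implicit.
Unset Printing Implicit Defensive.

Import Order.TTheory GRing.Theory Num.Theory.

Local Open Scope classical_set_scope.
Local Open Scope ring_scope.

(** * Samples as lists, and their traces *)

Section Lists.

Fixpoint lists (T : Type) (m : nat) (L : seq T) : seq (seq T) :=
  if m is m'.+1 then [seq x :: t | x <- L, t <- lists m' L] else [:: [::]].

Lemma size_lists (T : eqType) m (L : seq T) t : t \in lists m L -> size t = m.
Proof.
elim: m t => [|m IH] t /=; first by rewrite inE => /eqP->.
by case/allpairsP => -[x s] /= [_ /IH <- ->].
Qed.

Lemma mem_lists (T : eqType) m (L : seq T) t :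
  t \in lists m L -> {subset t <= L}.
Proof.
elim: m t => [|m IH] t /=; first by rewrite inE => /eqP->.
case/allpairsP => -[x s] /= [xL /IH sL ->] y.
by rewrite inE => /orP [/eqP->|/sL].
Qed.

Variable R : realType.

Lemma big_lists0 (T : Type) (L : seq T) (F : seq T -> R) :
  \sum_(t <- lists 0 L) F t = F [::].
Proof. by rewrite /= big_seq1. Qed.

Lemma big_listsS (T : Type) m (L : seq T) (F : seq T -> R) :
  \sum_(t <- lists m.+1 L) F t = \sum_(x <- L) \sum_(t <- lists m L) F (x :: t).
Proof. by rewrite big_allpairs_dep. Qed.

Lemma sum_lists_prod (T : Type) m (L : seq T) (a : T -> R) :
  \sum_(t <- lists m L) \prod_(x <- t) a x = (\sum_(x <- L) a x) ^+ m.
Proof.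
elim: m => [|m IH]; first by rewrite big_lists0 big_nil.
rewrite big_listsS exprS -IH mulr_suml; apply: eq_bigr => x _.
by rewrite mulr_sumr; apply: eq_bigr => t _; rewrite big_cons.
Qed.

Lemma sum_lists_const (T : Type) m (L : seq T) (c : R) :
  \sum_(t <- lists m L) c = (size L)%:R ^+ m * c.
Proof.
elim: m => [|m IH]; first by rewrite big_lists0 mul1r.
rewrite big_listsS exprS -mulrA -IH.
by rewrite big_const_seq count_predT iter_addr_0 mulr_natl.
Qed.

(** Passes from the tuples of [samp_expect] to lists, where sums unfold along head and tail. *)
Lemma sum_tuples_lists (N m : nat) (a : nat -> R) (F : seq nat -> R) :
  \sum_(t : m.-tuple 'I_N)
     (\prod_(j < m) a (tnth t j)) * F [seq nat_of_ord i | i <- t] =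
  \sum_(t <- lists m (iota 0 N)) (\prod_(x <- t) a x) * F t.
Proof.
elim: m F => [|m IH] F.
  rewrite big_lists0 big_nil (big_pred1 [tuple]) ?big_ord0 //= => t.
  by apply/esym/eqP; exact: tuple0.
rewrite big_listsS.
transitivity (\sum_(p : 'I_N * m.-tuple 'I_N)
   a p.1 * (\prod_(j < m) a (tnth p.2 j)) * F [seq nat_of_ord i | i <- (p.1 :: p.2)]).
  rewrite (reindex (fun p : 'I_N * m.-tuple 'I_N => [tuple of p.1 :: p.2])) /=.
    apply: eq_bigr => -[x t] _ /=; rewrite big_ord_recl.
    congr (_ * _ * _); apply: eq_bigr => j _.
    by congr (a _); rewrite !(tnth_nth x).
  exists (fun t => (thead t, [tuple of behead t])) => [[x t] _|t _] /=.
    by congr pair; apply: val_inj.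
  by rewrite -tuple_eta.
rewrite -(pair_big xpredT xpredT (fun (i : 'I_N) (t : m.-tuple 'I_N) =>
  a i * (\prod_(j < m) a (tnth t j)) * F [seq nat_of_ord i | i <- i :: t])) /=.
have E : iota 0 N = index_iota 0 N by rewrite /index_iota subn0.
rewrite [X in _ = bigop _ X _]E big_mkord.
apply: eq_bigr => i _.
transitivity (\sum_(t : m.-tuple 'I_N) (\prod_(j < m) a (tnth t j)) *
   (a i * F (nat_of_ord i :: [seq nat_of_ord i | i <- t]))).
  by apply: eq_bigr => t _; rewrite mulrCA !mulrA.
rewrite (IH (fun s => a i * F (nat_of_ord i :: s))).
by apply: eq_bigr => t _; rewrite big_cons mulrCA !mulrA.
Qed.

(** Index i, counted from 0, stands for the element i + 1; hence the negated parity. *)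
Definition trace_of (s : seq nat) : seq bool := [seq ~~ odd i | i <- sort leq s].

Lemma trace_seq_mset (s : seq nat) :
  trace (seq_mset [seq i.+1 | i <- s]) = trace_of s.
Proof.
rewrite /trace /trace_of.
have leq_tot : total leq by exact: leq_total.
have -> : sort leq (enum_mset (seq_mset [seq i.+1 | i <- s])) =
          sort leq [seq i.+1 | i <- s].
  by apply/(perm_sortP leq_tot leq_trans anti_leq); exact: perm_eq_seq_mset.
rewrite sort_map -map_comp; apply: eq_map => i /=; by [].
Qed.

Lemma samp_expect_lists (N m : nat) (a : nat -> R) (g : seq bool -> R) :
  samp_expect (fun i : 'I_N => a i) m (fun S => g (trace S)) =
  \sum_(t <- lists m (iota 0 N)) (\prod_(x <- t) a x) * g (trace_of t).
Proof.
rewrite -(sum_tuples_lists N m a (fun t => g (trace_of t))).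
apply: eq_bigr => t _; congr (_ * g _).
by rewrite -trace_seq_mset -map_comp.
Qed.

End Lists.
(** * Noncommutative power series *)

Section Series.

Variable R : realType.
Implicit Types (F G H : seq bool -> R) (w : seq bool).

Definition words k : seq (seq bool) := lists k [:: true; false].

(* A function on words is read as a power series in noncommuting variables
   X_1 and X_0; [conv] is the product of series and [lexp b a] is exp (a X_b). *)
Fixpoint conv F G w : R :=
  F [::] * G w + (if w is x :: w' then conv (fun u => F (x :: u)) G w' else 0).

Definition ser1 w : R := (w == [::])%:R.

Lemma convE F G w :
  conv F G w = \sum_(i < (size w).+1) F (take i w) * G (drop i w).
Proof.
elim: w F => [|x w IH] F /=; first by rewrite big_ord1 addr0.
by rewrite big_ord_recl /= IH.
Qed.

Lemma eq_conv F F' G G' : F =1 F' -> G =1 G' -> conv F G =1 conv F' G'.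
Proof. by move=> eF eG w; rewrite !convE; apply: eq_bigr => i _; rewrite eF eG. Qed.

Lemma convDl F F' G w :
  conv (fun u => F u + F' u) G w = conv F G w + conv F' G w.
Proof. by rewrite !convE -big_split; apply: eq_bigr => i _; rewrite mulrDl. Qed.

Lemma convZl c F G w : conv (fun u => c * F u) G w = c * conv F G w.
Proof. by rewrite !convE mulr_sumr; apply: eq_bigr => i _; rewrite mulrA. Qed.

Lemma convBl F F' G w :
  conv (fun u => F u - F' u) G w = conv F G w - conv F' G w.
Proof.
by rewrite !convE -sumrB; apply: eq_bigr => i _; rewrite mulrBl.
Qed.

Lemma convBr F G G' w :
  conv F (fun u => G u - G' u) w = conv F G w - conv F G' w.
Proof.
by rewrite !convE -sumrB; apply: eq_bigr => i _; rewrite mulrBr.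
Qed.

Lemma convZr c F G w : conv F (fun u => c * G u) w = c * conv F G w.
Proof. by rewrite !convE mulr_sumr; apply: eq_bigr => i _; rewrite mulrCA. Qed.

Lemma conv_suml (I : Type) (r : seq I) (F : I -> seq bool -> R) G w :
  conv (fun u => \sum_(i <- r) F i u) G w = \sum_(i <- r) conv (F i) G w.
Proof.
rewrite convE (eq_bigr (fun k : 'I_(size w).+1 =>
  \sum_(i <- r) F i (take k w) * G (drop k w))); last by move=> k _; rewrite mulr_suml.
by rewrite exchange_big; apply: eq_bigr => i _; rewrite convE.
Qed.

Lemma conv_sumr (I : Type) (r : seq I) F (G : I -> seq bool -> R) w :
  conv F (fun u => \sum_(i <- r) G i u) w = \sum_(i <- r) conv F (G i) w.
Proof.
rewrite convE (eq_bigr (fun k : 'I_(size w).+1 =>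
  \sum_(i <- r) F (take k w) * G i (drop k w))); last by move=> k _; rewrite mulr_sumr.
by rewrite exchange_big; apply: eq_bigr => i _; rewrite convE.
Qed.

Lemma convA F G H w : conv F (conv G H) w = conv (conv F G) H w.
Proof.
elim: w F G => [|x w IH] F G /=; first by rewrite !addr0 mulrA.
rewrite convDl convZl IH !mulrDr addr0 !addrA mulrA; congr (_ + _ + _); ring.
Qed.

Lemma conv1s G w : conv ser1 G w = G w.
Proof.
rewrite convE big_ord_recl big1 ?addr0 /=; first by rewrite take0 drop0 /ser1 eqxx mul1r.
by move=> i _; case: w i => [|x w] i /=; [case: i|rewrite /ser1 /= mul0r].
Qed.

Lemma conv_ge0 F G w : (forall u, 0 <= F u) -> (forall u, 0 <= G u) ->
  0 <= conv F G w.
Proof. by move=> F0 G0; rewrite convE sumr_ge0 // => i _; rewrite mulr_ge0. Qed.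

Lemma conv_norm F F' G G' w :
  (forall u, `|F u| <= F' u) -> (forall u, `|G u| <= G' u) ->
  `|conv F G w| <= conv F' G' w.
Proof.
move=> hF hG; rewrite !convE; apply: le_trans (ler_norm_sum _ _ _) _.
by apply: ler_sum => i _; rewrite normrM ler_pM.
Qed.

Lemma conv_le F F' G G' w :
  (forall u, 0 <= F u) -> (forall u, 0 <= G u) ->
  (forall u, F u <= F' u) -> (forall u, G u <= G' u) ->
  conv F G w <= conv F' G' w.
Proof.
move=> F0 G0 hF hG; rewrite !convE.
by apply: ler_sum => i _; rewrite ler_pM.
Qed.

Lemma sum_words0 (g : seq bool -> R) : \sum_(w <- words 0) g w = g [::].
Proof. exact: big_lists0. Qed.

Lemma sum_wordsS k (g : seq bool -> R) : \sum_(w <- words k.+1) g w =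
  \sum_(w <- words k) g (true :: w) + \sum_(w <- words k) g (false :: w).
Proof. by rewrite /words big_listsS !big_cons big_nil addr0. Qed.

Lemma size_words k w : w \in words k -> size w = k.
Proof. exact: size_lists. Qed.

(** The test function f stays arbitrary and keeps the prefix u, because the verdict of a tester
    depends on the whole trace. *)
Lemma sum_conv m F G (f : seq bool -> R) :
  \sum_(w <- words m) conv F G w * f w =
  \sum_(k < m.+1) \sum_(u <- words k)
     F u * \sum_(v <- words (m - k)) G v * f (u ++ v).
Proof.
elim: m F f => [|m IH] F f.
  by rewrite big_ord1 !sum_words0 /= addr0 mulrA.
rewrite sum_wordsS big_ord_recl sum_words0 subn0.
transitivity (F [::] * (\sum_(v <- words m.+1) G v * f v) +
  (\sum_(w <- words m) conv (fun u => F (true :: u)) G w * f (true :: w) +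
   \sum_(w <- words m) conv (fun u => F (false :: u)) G w * f (false :: w))).
  rewrite sum_wordsS mulrDr !mulr_sumr addrACA.
  by congr (_ + _); rewrite -big_split; apply: eq_bigr => w _ /=; rewrite mulrDl mulrA.
congr (_ + _); rewrite (IH _ (fun w => f (true :: w))) (IH _ (fun w => f (false :: w))).
by rewrite -big_split; apply: eq_bigr => k _; rewrite sum_wordsS.
Qed.

(** Substituting one commuting variable X for both letters turns F into exp (s X); hence masses add
    under [conv]. *)
Definition has_mass F (s : R) :=
  forall k, \sum_(w <- words k) F w = s ^+ k / k`!%:R.

Lemma sum_div_fact m (x y : R) :
  \sum_(k < m.+1) x ^+ k / k`!%:R * (y ^+ (m - k) / (m - k)`!%:R) =
  (x + y) ^+ m / m`!%:R.
Proof.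
rewrite addrC exprDn mulr_suml; apply: eq_bigr => k _.
have km : (k <= m)%N by rewrite -ltnS.
have e : m`!%:R = ('C(m, k) * (k`! * (m - k)`!))%:R :> R by rewrite bin_fact.
rewrite e !natrM -mulr_natl.
have a0 : k`!%:R != 0 :> R by rewrite pnatr_eq0 -lt0n fact_gt0.
have b0 : (m - k)`!%:R != 0 :> R by rewrite pnatr_eq0 -lt0n fact_gt0.
have c0 : 'C(m, k)%:R != 0 :> R by rewrite pnatr_eq0 -lt0n bin_gt0.
by field; rewrite a0 b0 c0.
Qed.

Lemma has_mass_conv F G s s' :
  has_mass F s -> has_mass G s' -> has_mass (conv F G) (s + s').
Proof.
move=> mF mG m; have := sum_conv m F G (fun=> 1).
rewrite (eq_bigr (conv F G)) => [->|w _]; last by rewrite mulr1.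
rewrite -sum_div_fact; apply: eq_bigr => k _.
rewrite -mF -mG mulr_suml; apply: eq_bigr => u _.
by congr (_ * _); apply: eq_bigr => v _; rewrite mulr1.
Qed.

Lemma has_mass_ser1 : has_mass ser1 0.
Proof.
case=> [|k]; first by rewrite sum_words0 /ser1 /= fact0 divr1.
by rewrite expr0n mul0r sum_wordsS /ser1 /= !big1_eq addr0.
Qed.

(* All words get the weight that exp (a (X_0 + X_1)) gives them. *)
Definition eser (a : R) w : R := a ^+ size w / (size w)`!%:R.

Lemma eser_ge0 a w : 0 <= a -> 0 <= eser a w.
Proof. by move=> a0; rewrite divr_ge0 ?exprn_ge0. Qed.

Lemma conv_eser a b w : conv (eser a) (eser b) w = eser (a + b) w.
Proof.
rewrite convE /eser -sum_div_fact; apply: eq_bigr => k _.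
by rewrite size_takel 1?size_drop // -ltnS.
Qed.

Lemma ler_eser a b w : 0 <= a -> a <= b -> eser a w <= eser b w.
Proof.
move=> a0 ab; rewrite /eser ler_wpM2r ?invr_ge0 //.
by rewrite lerXn2r ?nnegrE // (le_trans a0).
Qed.

Definition lexp (b : bool) (a : R) w : R := (all (pred1 b) w)%:R * eser a w.

Lemma lexp_ge0 b a w : 0 <= a -> 0 <= lexp b a w.
Proof. by move=> a0; rewrite mulr_ge0 ?ler0n ?eser_ge0. Qed.

Lemma lexp_le b a w : 0 <= a -> lexp b a w <= eser a w.
Proof.
by move=> a0; rewrite /lexp; case: all; rewrite ?mul1r // mul0r eser_ge0.
Qed.

Lemma sum_lexp b a k (g : seq bool -> R) :
  \sum_(w <- words k) lexp b a w * g w = a ^+ k / k`!%:R * g (nseq k b).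
Proof.
have -> : \sum_(w <- words k) lexp b a w * g w =
    \sum_(w <- words k) (all (pred1 b) w)%:R * (a ^+ k / k`!%:R * g w).
  rewrite !big_seq; apply: eq_bigr => w /size_words sw.
  by rewrite /lexp /eser sw !mulrA.
suff E (h : seq bool -> R) :
  \sum_(w <- words k) (all (pred1 b) w)%:R * h w = h (nseq k b).
  by rewrite E.
elim: k h => [|k IH] h; first by rewrite sum_words0 mul1r.
rewrite sum_wordsS /= -(IH (fun w => h (b :: w))).
case: b {IH}; [rewrite [X in _ + X]big1 | rewrite [X in X + _]big1];
  by move=> *; rewrite /= ?mul0r ?addr0 ?add0r.
Qed.

Lemma has_mass_lexp b a : has_mass (lexp b a) a.
Proof.
move=> k; have := sum_lexp b a k (fun=> 1).
by rewrite mulr1 => <-; apply: eq_bigr => w _; rewrite mulr1.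
Qed.

(** The letters alternate as the parities of consecutive integers do. With s the weights of an
    interval, the coefficient of a word is, up to a factorial, the total weight of the samples with
    that trace. *)
Fixpoint ps (b : bool) (s : seq R) : seq bool -> R :=
  if s is a :: s' then conv (lexp b a) (ps (~~ b) s') else ser1.

Lemma ps_cat b s s' w :
  ps b (s ++ s') w = conv (ps b s) (ps (b (+) odd (size s)) s') w.
Proof.
elim: s b w => [|a s IH] b w /=; first by rewrite addbF conv1s.
rewrite -convA; apply: eq_conv => // u; rewrite IH.
by case: b; case: odd.
Qed.

Lemma ps_ge0 b s w : (forall a, a \in s -> 0 <= a) -> 0 <= ps b s w.
Proof.
elim: s b w => [|a s IH] b w h /=; first by rewrite ler0n.
apply: conv_ge0 => u; first by rewrite lexp_ge0 // h // inE eqxx.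
by apply: IH => x xs; apply: h; rewrite inE xs orbT.
Qed.

Lemma ps_le b s w : (forall a, a \in s -> 0 <= a) ->
  ps b s w <= eser (\sum_(a <- s) a) w.
Proof.
elim: s b w => [|a s IH] b w h /=.
  rewrite big_nil /ser1 /eser; case: w => [|x w] /=; first by rewrite fact0 divr1.
  by rewrite expr0n mul0r.
have hs x : x \in s -> 0 <= x by move=> xs; apply: h; rewrite inE xs orbT.
have a0 : 0 <= a by rewrite h // inE eqxx.
rewrite big_cons -conv_eser; apply: conv_le => u; first exact: lexp_ge0.
- exact: ps_ge0.
- exact: lexp_le.
- exact: IH.
Qed.

Lemma has_mass_ps b s : has_mass (ps b s) (\sum_(a <- s) a).
Proof.
elim: s b => [|a s IH] b; first by rewrite big_nil; exact: has_mass_ser1.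
by rewrite big_cons; apply: has_mass_conv => //; exact: has_mass_lexp.
Qed.

(** * Traces of samples as coefficients of a product of exponentials *)

(** The k draws of the head x are moved to the front, which the symmetry of phi permits; the
    binomial coefficient counts their positions. In the induction the first draw is x or comes from
    L, and Pascal's rule joins the two cases. *)
Lemma sum_lists_cons (T : eqType) (x : T) (L : seq T) (a : T -> R) m
    (phi : seq T -> R) :
  (forall s t, perm_eq s t -> phi s = phi t) ->
  \sum_(t <- lists m (x :: L)) (\prod_(y <- t) a y) * phi t =
  \sum_(k < m.+1) 'C(m, k)%:R * a x ^+ k *
     \sum_(t <- lists (m - k) L) (\prod_(y <- t) a y) * phi (nseq k x ++ t).
Proof.
elim: m phi => [|m IH] phi phiP.
  by rewrite big_ord1 !big_lists0 big_nil /= bin0 !mul1r.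
rewrite big_listsS big_cons.
have step y : \sum_(t <- lists m (x :: L)) (\prod_(z <- y :: t) a z) * phi (y :: t)
    = \sum_(k < m.+1) 'C(m, k)%:R * a x ^+ k * (a y *
     \sum_(t <- lists (m - k) L) (\prod_(z <- t) a z) * phi (y :: nseq k x ++ t)).
  transitivity (a y * \sum_(t <- lists m (x :: L)) (\prod_(z <- t) a z) * phi (y :: t)).
    by rewrite mulr_sumr; apply: eq_bigr => t _; rewrite big_cons mulrA.
  rewrite (IH (fun t => phi (y :: t))); last first.
    by move=> s t st; apply: phiP; rewrite perm_cons.
  by rewrite mulr_sumr; apply: eq_bigr => k _; ring.
pose Psi k := \sum_(t <- lists (m.+1 - k) L) (\prod_(z <- t) a z) * phi (nseq k x ++ t).
have -> : \sum_(y <- L) \sum_(t <- lists m (x :: L)) (\prod_(z <- y :: t) a z) * phi (y :: t)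
   = \sum_(k < m.+1) 'C(m, k)%:R * a x ^+ k * Psi k.
  rewrite (eq_bigr _ (fun y _ => step y)) exchange_big; apply: eq_bigr => k _.
  rewrite -mulr_sumr; congr (_ * _).
  rewrite /Psi subSn ?big_listsS -1?ltnS //; apply: eq_bigr => y _.
  rewrite mulr_sumr; apply: eq_bigr => t _; rewrite big_cons mulrA.
  congr (_ * _); apply: phiP.
  by rewrite -(cat1s y t) -(cat1s y (_ ++ t)) perm_catCA.
rewrite step [in RHS]big_ord_recl bin0 expr0 !mul1r -/(Psi 0).
rewrite [X in _ + X = _]big_ord_recl bin0 expr0 !mul1r addrCA; congr (_ + _).
have -> : \sum_(k < m) 'C(m, bump 0 k)%:R * a x ^+ bump 0 k * Psi (bump 0 k) =
   \sum_(k < m.+1) 'C(m, k.+1)%:R * a x ^+ k.+1 * Psi k.+1.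
  by rewrite big_ord_recr /= bin_small // !mul0r addr0.
rewrite -big_split; apply: eq_bigr => k _ /=.
by rewrite /bump /= add1n binS natrD exprS /Psi subSS; ring.
Qed.

(** The k copies of the least element i fill the first k places of the sorted sample, so i
    contributes a factor [lexp] on the left. Writing the binomial coefficient as m! / (k! (m - k)!)
    distributes the factorials. *)
Lemma lists_trace_ps (a : nat -> R) i N m (f : seq bool -> R) :
  \sum_(t <- lists m (iota i N)) (\prod_(x <- t) a x) * f (trace_of t) =
  m`!%:R * \sum_(w <- words m) ps (~~ odd i) [seq a x | x <- iota i N] w * f w.
Proof.
elim: N i m f => [|N IH] i m f.
  case: m => [|m]; first by rewrite big_lists0 sum_words0 big_nil /= /ser1 !mul1r.
  rewrite big_listsS big_nil big1_seq ?mulr0 // => w /andP[_ /size_words].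
  by case: w => //= x w _; rewrite /ser1 /= mul0r.
rewrite -[iota i N.+1]/(i :: iota i.+1 N) sum_lists_cons; last first.
  move=> s t st; rewrite /trace_of; congr (f (map _ _)).
  by apply/(perm_sortP leq_total leq_trans anti_leq).
rewrite /= sum_conv mulr_sumr; apply: eq_bigr => k _.
rewrite sum_lexp.
(* All entries of t exceed i, so [nseq k i] followed by the sorted t is already sorted. *)
have E : \sum_(t <- lists (m - k) (iota i.+1 N)) \prod_(y <- t) a y *
      f (trace_of (nseq k i ++ t)) =
   \sum_(t <- lists (m - k) (iota i.+1 N)) (\prod_(y <- t) a y) *
      f (nseq k (~~ odd i) ++ trace_of t).
  rewrite !big_seq; apply: eq_bigr => t /mem_lists tL; congr (_ * f _).
  rewrite /trace_of -(map_nseq k (fun x => ~~ odd x)) -map_cat; congr map.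
  apply: (@sorted_eq _ leq leq_trans anti_leq).
  - exact/sort_sorted/leq_total.
  - have : all (leq i) (sort leq t).
      apply/allP => x; rewrite mem_sort => /tL; rewrite mem_iota => /andP[/ltnW].
      by [].
    elim: {+}(nat_of_ord k) => [|j IHj] h /=; first exact/sort_sorted/leq_total.
    rewrite (path_sortedE leq_trans) IHj // andbT all_cat h andbT.
    by apply/allP => x /nseqP[->].
  - by rewrite perm_sort perm_cat2l perm_sym perm_sort.
rewrite E (IH i.+1 (m - k)%N (fun w => f (nseq k (~~ odd i) ++ w))) /=.
have km : (k <= m)%N by rewrite -ltnS.
rewrite -[in RHS](bin_fact km) !natrM.
have a0 : k`!%:R != 0 :> R by rewrite pnatr_eq0 -lt0n fact_gt0.
by field.
Qed.

End Series.

(** * Decomposition into superblocks *)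

Section Hiding.

Variable R : realType.

Fixpoint wlists (l : seq nat) : seq (seq (seq bool)) :=
  if l is k :: l' then [seq u :: us | u <- words k, us <- wlists l'] else [:: [::]].

(* All lists of J lengths with sum at most m; what is missing to m is the length
   of the trace of the elements outside the superblocks. *)
Fixpoint comps (J m : nat) : seq (seq nat) :=
  if J is J'.+1 then [seq k :: l | k <- iota 0 m.+1, l <- comps J' (m - k)]
  else [:: [::]].

Lemma sum_wlists_cons k l (F : seq (seq bool) -> R) :
  \sum_(us <- wlists (k :: l)) F us =
  \sum_(u <- words k) \sum_(us <- wlists l) F (u :: us).
Proof. by rewrite /= big_allpairs_dep. Qed.

Lemma sum_wlists_prod l (F : seq bool -> R) :
  \sum_(us <- wlists l) \prod_(u <- us) F u =
  \prod_(k <- l) \sum_(u <- words k) F u.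
Proof.
elim: l => [|k l IH]; first by rewrite big_seq1 !big_nil.
rewrite sum_wlists_cons big_cons -IH mulr_suml; apply: eq_bigr => u _.
by rewrite mulr_sumr; apply: eq_bigr => us _; rewrite big_cons.
Qed.

Lemma sum_comps_cons J m (F : seq nat -> R) :
  \sum_(l <- comps J.+1 m) F l =
  \sum_(k < m.+1) \sum_(l <- comps J (m - k)) F (nat_of_ord k :: l).
Proof.
rewrite [comps _ _]/(allpairs_dep _ (iota 0 m.+1) (fun k => comps J (m - k))).
by rewrite big_allpairs_dep -[iota 0 _]/(index_iota 0 m.+1) big_mkord.
Qed.

(** Splits a trace into more than a tester sees: first the lengths l, then the superblock traces us,
    then the rest v. The test function still sees only the concatenation. *)
Lemma sum_iter_conv (T U : seq bool -> R) J m (f : seq bool -> R) :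
  \sum_(w <- words m) iter J (conv T) U w * f w =
  \sum_(l <- comps J m) \sum_(us <- wlists l) (\prod_(u <- us) T u) *
     \sum_(v <- words (m - sumn l)) U v * f (flatten us ++ v).
Proof.
elim: J m f => [|J IH] m f.
  by rewrite /= !big_seq1 big_nil mul1r subn0.
rewrite sum_comps_cons iterS sum_conv; apply: eq_bigr => k _.
rewrite (eq_bigr _ (fun u _ => congr1 (fun x => T u * x)
  (IH (m - k)%N (fun v => f (u ++ v))))).
rewrite (eq_bigr _ (fun u _ => mulr_sumr _ _ _ _)) exchange_big.
apply: eq_bigr => l _; rewrite sum_wlists_cons; apply: eq_bigr => u _.
rewrite mulr_sumr; apply: eq_bigr => us _.
rewrite big_cons mulrA subnDA; congr (_ * _); apply: eq_bigr => v _.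
by rewrite /= catA.
Qed.

(** In the induction, (1 + h) (1 + 2 s) exceeds 1 + 2 (h + s) by h (2 s - 1), which is not
    positive. *)
Lemma prod_1D_le (l : seq nat) (h : nat -> R) :
  (forall k, 0 <= h k) -> \sum_(k <- l) h k <= 1 / 2 ->
  \prod_(k <- l) (1 + h k) <= 1 + 2 * \sum_(k <- l) h k.
Proof.
move=> h0; elim: l => [|k l IH]; first by rewrite !big_nil mulr0 addr0.
rewrite !big_cons => hs.
have s0 : 0 <= \sum_(j <- l) h j by apply: sumr_ge0.
have hk := h0 k.
have {IH} := IH ltac:(lra).
set s := \sum_(j <- l) h j in s0 hs *; set p := \prod_(j <- l) _ => IH.
have : (1 + h k) * p <= (1 + h k) * (1 + 2 * s) by rewrite ler_wpM2l //; lra.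
nra.
Qed.

(** In the application S is a superblock with uniform weights, T the perturbed one averaged over its
    heavy positions, and U the elements outside the superblocks. *)
Variables (S T U : seq bool -> R) (sigma rho kappa c : R) (eta : nat -> R).
Hypotheses (S0 : forall w, 0 <= S w) (T0 : forall w, 0 <= T w)
  (U0 : forall w, 0 <= U w).
Hypotheses (sigma0 : 0 <= sigma) (rho0 : 0 <= rho).
Hypotheses (mS : has_mass S sigma) (mT : has_mass T sigma) (mU : has_mass U rho).
Hypothesis close : forall w, `|T w - S w| <= eta (size w) * S w.
Hypothesis etaP : forall k, eta k ^+ 2 <= kappa * c ^+ k.

(** S and T have equal mass, so the lengths l have the same law under both, and only the traces of
    given lengths need comparison. *)
Let mass (l : seq nat) : R := \prod_(k <- l) (sigma ^+ k / k`!%:R).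
Let chi (l : seq nat) : R := \sum_(k <- l) eta k ^+ 2.

Let mass_ge0 l : 0 <= mass l.
Proof. by apply: prodr_ge0 => k _; rewrite divr_ge0 ?exprn_ge0. Qed.

(** This is (T - S)^2 / S <= eta^2 S with the square expanded; where S vanishes, so does T. *)
Let chi_sq w : T w ^+ 2 / S w <= 2 * T w - S w + eta (size w) ^+ 2 * S w.
Proof.
have := close w; have [->|Sn0] := eqVneq (S w) 0.
  by rewrite subr0 mulr0 normr_le0 => /eqP->; rewrite invr0 !mulr0 subr0 addr0.
have Sp : 0 < S w by rewrite lt_neqAle eq_sym Sn0 S0.
move=> h; rewrite ler_pdivrMr //.
have : (T w - S w) ^+ 2 <= (eta (size w) * S w) ^+ 2.
  by rewrite -[X in X <= _]real_normK ?num_real // lerXn2r ?nnegrE // (le_trans _ h).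
clear h; move: (T w) (S w) (eta _) => x y e h.
rewrite -subr_ge0.
have -> : (2 * x - y + e ^+ 2 * y) * y - x ^+ 2 = (e * y) ^+ 2 - (x - y) ^+ 2 by ring.
by rewrite subr_ge0.
Qed.

Let sum_chi_sq k :
  \sum_(w <- words k) T w ^+ 2 / S w <= sigma ^+ k / k`!%:R * (1 + eta k ^+ 2).
Proof.
apply: (@le_trans _ _ (\sum_(w <- words k) (2 * T w - S w + eta k ^+ 2 * S w))).
  rewrite big_seq [leRHS]big_seq; apply: ler_sum => w /size_words sw.
  by have := chi_sq w; rewrite sw.
rewrite big_split /= sumrB -!mulr_sumr mS mT; lra.
Qed.

Let pS us : R := \prod_(u <- us) S u.
Let pT us : R := \prod_(u <- us) T u.

Let pS0 us : 0 <= pS us. Proof. by apply: prodr_ge0. Qed.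
Let pT0 us : 0 <= pT us. Proof. by apply: prodr_ge0. Qed.

Let pST us : pS us = 0 -> pT us = 0.
Proof.
rewrite /pS /pT; elim: us => [|u us IH]; first by rewrite !big_nil.
rewrite !big_cons => /eqP; rewrite mulf_eq0 => /orP[/eqP Su|/eqP/IH->].
  have := close u; rewrite Su subr0 mulr0 normr_le0 => /eqP->.
  by rewrite mul0r.
by rewrite mulr0.
Qed.

Let sum_pS l : \sum_(us <- wlists l) pS us = mass l.
Proof. by rewrite sum_wlists_prod; apply: eq_bigr => k _; rewrite mS. Qed.

Let sum_pT l : \sum_(us <- wlists l) pT us = mass l.
Proof. by rewrite sum_wlists_prod; apply: eq_bigr => k _; rewrite mT. Qed.

(* If [chi l >= 1 / 2], the bound holds because the left side is at most
   [mass l * M]; this keeps the bound linear in [chi l]. *)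
Lemma fixed_lengths_gap l (f : seq (seq bool) -> R) (M t : R) :
  (forall us, 0 <= f us <= M) -> 0 < t -> t <= 1 / 4 ->
  \sum_(us <- wlists l) (pS us - pT us) * f us <=
    mass l * M * (t + chi l / (2 * t)).
Proof.
move=> fM t0 t4.
have M0 : 0 <= M by have /andP[/le_trans] := fM [::]; apply.
have [hbig|hsmall] := lerP (1 / 2) (chi l).
  apply: (@le_trans _ _ (\sum_(us <- wlists l) pS us * M)).
    apply: ler_sum => us _; have /andP[f0 f1] := fM us.
    apply: (@le_trans _ _ (pS us * f us)); last exact: ler_wpM2l.
    by rewrite ler_wpM2r // lerBlDr lerDl.
  rewrite -mulr_suml sum_pS ler_peMr ?mulr_ge0 //.
  apply: (@le_trans _ _ (chi l / (2 * t))); last by rewrite lerDr ltW.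
  by rewrite ler_pdivlMr; lra.
(* The inequality |P - Q| <= t P + (P - Q)^2 / (4 t P), with the square expanded, leads to a
   chi-square distance. *)
apply: (@le_trans _ _ (\sum_(us <- wlists l)
    (M * (t * pS us) + M / (4 * t) * (pT us ^+ 2 / pS us - 2 * pT us + pS us)))).
  apply: ler_sum => us _; have /andP[f0 f1] := fM us.
  have [P0|Pn0] := eqVneq (pS us) 0.
    by rewrite (pST P0) P0; have : (0 : R) <= 0 by []; rewrite invr0; lra.
  have Pp : 0 < pS us by rewrite lt_neqAle eq_sym Pn0 pS0.
  apply: (@le_trans _ _ (M * `|pS us - pT us|)).
    rewrite mulrC; apply: (@le_trans _ _ (f us * `|pS us - pT us|)).
      by rewrite ler_wpM2l // ler_norm.
    by rewrite ler_wpM2r.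
  rewrite -mulrA -mulrDr ler_wpM2l //.
  set P := pS us in Pp *; set Q := pT us.
  have -> : t * P + (4 * t)^-1 * (Q ^+ 2 / P - 2 * Q + P) =
    ((2 * t * P) ^+ 2 + (P - Q) ^+ 2) / (4 * t * P).
    by field; rewrite !gt_eqF.
  rewrite ler_pdivlMr ?mulr_gt0 //.
  have : (P - Q) ^+ 2 = `|P - Q| ^+ 2 by rewrite real_normK ?num_real.
  move=> ->; have := sqr_ge0 (2 * t * P - `|P - Q|); rewrite !expr2; nra.
rewrite big_split -!mulr_sumr big_split sumrB -!mulr_sumr /= sum_pS sum_pT.
(* For fixed lengths the second moment is a product over the superblocks. *)
have X : \sum_(us <- wlists l) pT us ^+ 2 / pS us <= mass l * (1 + 2 * chi l).
  have -> : \sum_(us <- wlists l) pT us ^+ 2 / pS us =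
            \sum_(us <- wlists l) \prod_(u <- us) (T u ^+ 2 / S u).
    apply: eq_bigr => us _; rewrite /pT /pS.
    by rewrite -prodrXl -prodfV -big_split.
  rewrite sum_wlists_prod.
  apply: (@le_trans _ _ (\prod_(k <- l) (sigma ^+ k / k`!%:R * (1 + eta k ^+ 2)))).
    apply: ler_prod => k _; rewrite sum_chi_sq andbT.
    by apply: sumr_ge0 => w _; rewrite divr_ge0 ?sqr_ge0.
  rewrite big_split; apply: ler_wpM2l; first exact: mass_ge0.
  apply: (@prod_1D_le l (fun k => eta k ^+ 2)); last exact: ltW.
  by move=> k; exact: sqr_ge0.
have -> : mass l * M * (t + chi l / (2 * t)) =
  M * (t * mass l) + M / (4 * t) * (2 * mass l * chi l).
  by field; rewrite gt_eqF.
rewrite lerD2l; apply: ler_wpM2l; last lra.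
by rewrite divr_ge0 // mulr_ge0 // ltW.
Qed.

Lemma sum_comps_mass J m :
  \sum_(l <- comps J m) mass l * (rho ^+ (m - sumn l) / (m - sumn l)`!%:R) =
  (J%:R * sigma + rho) ^+ m / m`!%:R.
Proof.
elim: J m => [|J IH] m.
  by rewrite big_seq1 /mass big_nil mul1r subn0 mul0r add0r.
rewrite sum_comps_cons.
have -> : J.+1%:R * sigma + rho = sigma + (J%:R * sigma + rho).
  by rewrite -natr1; ring.
rewrite -sum_div_fact; apply: eq_bigr => k _.
rewrite -IH mulr_sumr; apply: eq_bigr => l _.
by rewrite /mass big_cons /= subnDA -!mulrA.
Qed.

(** As eta k ^+ 2 <= kappa c^k, the term of one superblock in [chi] replaces that superblock's sigma
    by c sigma: an exponential moment of its length. The J superblocks contribute alike. *)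
Lemma sum_comps_chi J m :
  \sum_(l <- comps J m)
    mass l * (rho ^+ (m - sumn l) / (m - sumn l)`!%:R) * chi l <=
  J%:R * kappa * ((J%:R * sigma + rho + (c - 1) * sigma) ^+ m / m`!%:R).
Proof.
elim: J m => [|J IH] m.
  by rewrite big_seq1 /chi big_nil mulr0 !mul0r.
rewrite sum_comps_cons.
(* A bounds the term of the first superblock, B those of the others. *)
pose A := \sum_(k < m.+1) kappa * ((c * sigma) ^+ k / k`!%:R *
  ((J%:R * sigma + rho) ^+ (m - k) / (m - k)`!%:R)).
pose B := \sum_(k < m.+1) J%:R * kappa * (sigma ^+ k / k`!%:R *
  ((J%:R * sigma + rho + (c - 1) * sigma) ^+ (m - k) / (m - k)`!%:R)).
apply: (@le_trans _ _ (A + B)); last first.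
  rewrite /A /B -!mulr_sumr !sum_div_fact.
  set x := c * sigma + _; set y := sigma + _.
  have -> : x = y by rewrite /x /y; ring.
  have -> : J.+1%:R * sigma + rho + (c - 1) * sigma = y.
    by rewrite /y -natr1; ring.
  by rewrite -natr1; lra.
rewrite /A /B -big_split; apply: ler_sum => k _ /=.
have -> : \sum_(l <- comps J (m - k)) mass (nat_of_ord k :: l) *
     (rho ^+ (m - (k + sumn l)) / (m - (k + sumn l))`!%:R) * chi (nat_of_ord k :: l) =
   sigma ^+ k / k`!%:R * (eta k ^+ 2 * (\sum_(l <- comps J (m - k))
      mass l * (rho ^+ (m - k - sumn l) / (m - k - sumn l)`!%:R)) +
    \sum_(l <- comps J (m - k))
      mass l * (rho ^+ (m - k - sumn l) / (m - k - sumn l)`!%:R) * chi l).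
  rewrite mulr_sumr -big_split mulr_sumr; apply: eq_bigr => l _ /=.
  rewrite /mass /chi !big_cons subnDA; ring.
rewrite sum_comps_mass mulrDr lerD //; last first.
  by rewrite mulrCA ler_wpM2l ?divr_ge0 ?exprn_ge0.
rewrite exprMn !mulrA -!mulrA.
set a := _ / (m - k)`!%:R.
have a0 : 0 <= a by rewrite divr_ge0 // exprn_ge0 // addr_ge0 // mulr_ge0.
have -> : kappa * (c ^+ k * (sigma ^+ k * (k`!%:R^-1 * a))) =
  sigma ^+ k * (k`!%:R^-1 * ((kappa * c ^+ k) * a)) by ring.
rewrite ler_wpM2l ?exprn_ge0 // ler_wpM2l ?invr_ge0 // mulrA -expr2.
exact: ler_wpM2r.
Qed.

Lemma iter_conv_gap J m (f : seq bool -> R) t :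
  (forall w, 0 <= f w <= 1) -> 0 < t -> t <= 1 / 4 ->
  \sum_(w <- words m) (iter J (conv S) U w - iter J (conv T) U w) * f w <=
  t * ((J%:R * sigma + rho) ^+ m / m`!%:R) +
  J%:R * kappa * ((J%:R * sigma + rho + (c - 1) * sigma) ^+ m / m`!%:R) / (2 * t).
Proof.
move=> f01 t0 t4; rewrite (eq_bigr _ (fun w _ => mulrBl _ _ _)) sumrB.
rewrite !sum_iter_conv -sumrB -sum_comps_mass.
pose g l := mass l * (rho ^+ (m - sumn l) / (m - sumn l)`!%:R).
apply: (@le_trans _ _ (\sum_(l <- comps J m) (t * g l + g l * chi l / (2 * t)))); last first.
  rewrite big_split -mulr_sumr -mulr_suml lerD2l ler_wpM2r ?invr_ge0 //.
    by rewrite mulr_ge0 // ltW.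
  exact: sum_comps_chi.
apply: ler_sum => l _.
rewrite -sumrB (eq_bigr _ (fun us _ => esym (mulrBl _ _ _))).
(* Here M is the mass of the rest: summing out v leaves a test function of us between 0 and M. *)
apply: le_trans (fixed_lengths_gap _ _ t0 t4) _; last first.
- rewrite /g le_eqVlt; apply/orP; left; apply/eqP.
  by rewrite mulrDr mulrC; congr (_ + _); rewrite mulrA.
- move=> us; apply/andP; split.
    by apply: sumr_ge0 => v _; case/andP: (f01 (flatten us ++ v)) => *; exact: mulr_ge0.
  rewrite -mU; apply: ler_sum => v _; case/andP: (f01 (flatten us ++ v)) => *.
  by rewrite ler_piMr.
Qed.

End Hiding.

(** * Perturbed blocks *)

Section Block.

Variable R : realType.
Implicit Types (F G U : seq bool -> R) (w : seq bool).

Lemma sum_words_pick (g : seq bool -> R) w :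
  \sum_(w' <- words (size w)) g w' * (w' == w)%:R = g w.
Proof.
elim: w g => [|x w IH] g; first by rewrite sum_words0 eqxx mulr1.
rewrite sum_wordsS -(IH (fun u => g (x :: u))).
case: x; [rewrite [X in _ + X]big1 | rewrite [X in X + _]big1];
  by move=> *; rewrite ?eqseq_cons /= ?mulr0 ?addr0 ?add0r //;
  apply: eq_bigr => u _; rewrite eqseq_cons.
Qed.

Lemma iter_conv_ge0 F U n w :
  (forall u, 0 <= F u) -> (forall u, 0 <= U u) -> 0 <= iter n (conv F) U w.
Proof. by move=> F0 U0; elim: n w => //= n IH w; exact: conv_ge0. Qed.

Lemma iter_conv_cat F U n w :
  conv (iter n (conv F) (@ser1 R)) U w = iter n (conv F) U w.
Proof.
elim: n w => [|n IH] w /=; first exact: conv1s.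
by rewrite -convA; apply: eq_conv => // u; exact: IH.
Qed.

Lemma iter_conv_mul F U J B w :
  iter (J * B) (conv F) U w = iter J (conv (iter B (conv F) (@ser1 R))) U w.
Proof.
elim: J w => [|J IH] w //; rewrite mulSn iterD iterS -iter_conv_cat.
by apply: eq_conv => // u; exact: IH.
Qed.

Lemma has_mass_iter F U n s r :
  has_mass F s -> has_mass U r -> has_mass (iter n (conv F) U) (n%:R * s + r).
Proof.
move=> mF mU; elim: n => [|n IH]; first by rewrite mul0r add0r.
have -> : n.+1%:R * s + r = s + (n%:R * s + r) by rewrite -natr1; ring.
exact: has_mass_conv.
Qed.

(* The shape of the bound makes the relation stable under [conv] for e <= 1:
   (1 + e (x - 1)) (1 + e (y - 1)) <= 1 + e (x y - 1) for x, y >= 1. *)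
Definition rel_close (e : R) F G :=
  forall w, `|F w - G w| <= e * (5 ^+ size w - 1) * G w.

Lemma rel_close_ser1 e : rel_close e (@ser1 R) (@ser1 R).
Proof.
move=> w; rewrite subrr normr0 /ser1; case: eqP => [->|_]; last by rewrite mulr0.
by rewrite /= subrr mulr0 mul0r.
Qed.

Lemma rel_close_conv e F G F' G' : 0 <= e <= 1 ->
  (forall w, 0 <= G w) -> (forall w, 0 <= G' w) ->
  rel_close e F G -> rel_close e F' G' -> rel_close e (conv F F') (conv G G').
Proof.
move=> /andP[e0 e1] G0 G0' cF cF' w; rewrite !convE -sumrB mulr_sumr.
apply: le_trans (ler_norm_sum _ _ _) _; apply: ler_sum => i _.
set u := take i w; set v := drop i w.
have -> : size w = (size u + size v)%N by rewrite -size_cat cat_take_drop.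
have p5 k : 1 <= 5 ^+ k :> R by rewrite exprn_ege1 // ler1n.
have pu := p5 (size u); have pv := p5 (size v).
have := cF u; have := cF' v; have := G0 u; have := G0' v.
rewrite exprD; move: (5 ^+ _) pu (5 ^+ _) pv => x hx y hy.
move: (F u) (G u) (F' v) (G' v) => f g f' g' g0' g0 h' h.
have -> : f * f' - g * g' = (f - g) * (f' - g') + ((f - g) * g' + g * (f' - g')).
  by ring.
have b1 : `|(f - g) * (f' - g')| <= (e * (x - 1) * g) * (e * (y - 1) * g').
  by rewrite normrM ler_pM.
have b2 : `|(f - g) * g'| <= (e * (x - 1) * g) * g'.
  by rewrite normrM (ger0_norm g0') ler_wpM2r.
have b3 : `|g * (f' - g')| <= g * (e * (y - 1) * g').
  by rewrite normrM (ger0_norm g0) ler_wpM2l.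
apply: le_trans (ler_normD _ _) _.
apply: le_trans (lerD b1 (le_trans (ler_normD _ _) (lerD b2 b3))) _.
have q0 : 0 <= g * g' by rewrite mulr_ge0.
have r0 : 0 <= (x - 1) * (y - 1) * (g * g') by rewrite !mulr_ge0 // subr_ge0.
have : 0 <= e * (1 - e) * ((x - 1) * (y - 1) * (g * g')).
  by rewrite !mulr_ge0 // subr_ge0.
rewrite -subr_ge0 => h0; rewrite -subr_ge0.
apply: le_trans h0 _; rewrite subr0 le_eqVlt; apply/orP; left; apply/eqP; ring.
Qed.

Lemma rel_close_iter e F G n : 0 <= e <= 1 ->
  (forall w, 0 <= G w) -> rel_close e F G ->
  rel_close e (iter n (conv F) (@ser1 R)) (iter n (conv G) (@ser1 R)).
Proof.
move=> e01 G0 cF; elim: n => [|n IH]; first exact: rel_close_ser1.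
rewrite !iterS; apply: rel_close_conv => // w.
by apply: iter_conv_ge0 => // u; rewrite ler0n.
Qed.

(** One more factor multiplies the remainder by at most 1 + 2 th <= 3 and adds at most 4 k th^2 <= 2
    * 5^k th^2, where k is the length so far; 3 + 2 gives the base 5. *)
Lemma first_order_prod (th : R) (beta : nat -> R) (t : seq nat) :
  0 <= th <= 1 -> (forall y, `|beta y| <= 2) ->
  `|\prod_(y <- t) (1 + th * beta y) - 1 - th * \sum_(y <- t) beta y| <=
    th ^+ 2 * (5 ^+ size t - 1).
Proof.
move=> /andP[th0 th1] hb.
have hl (s : seq nat) : `|\sum_(y <- s) beta y| <= 2 * (size s)%:R.
  elim: s => [|y s IH]; first by rewrite big_nil normr0 mulr0.
  rewrite big_cons /= -natr1; apply: le_trans (ler_normD _ _) _.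
  by have := hb y; lra.
elim: t => [|y t IH]; first by rewrite !big_nil mulr0 subr0 subrr normr0 mulr0.
rewrite !big_cons /= (exprS 5).
have := hl t; have := hb y.
have n5 : 2 * (size t)%:R <= 5 ^+ size t :> R.
  rewrite -natrX -natrM ler_nat; elim: (size t) => // k; rewrite expnS; lia.
move: (\prod_(_ <- t) _) (\sum_(_ <- t) _) (beta y) IH => P l b IH hb' hl'.
have -> : (1 + th * b) * P - 1 - th * (b + l) =
  (P - 1 - th * l) * (1 + th * b) + th ^+ 2 * (b * l) by ring.
move: (5 ^+ _) n5 IH hl' => x n5 IH hl'.
have b1 : `|(P - 1 - th * l) * (1 + th * b)| <= th ^+ 2 * (x - 1) * 3.
  rewrite normrM ler_pM //; apply: le_trans (ler_normD _ _) _.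
  rewrite normr1 normrM (ger0_norm th0).
  have : th * `|b| <= 1 * 2 by rewrite ler_pM.
  lra.
have b2 : `|th ^+ 2 * (b * l)| <= th ^+ 2 * (2 * (2 * (size t)%:R)).
  by rewrite normrM (ger0_norm (sqr_ge0 th)) ler_wpM2l ?sqr_ge0 // normrM ler_pM.
apply: le_trans (ler_normD _ _) _; apply: le_trans (lerD b1 b2) _.
rewrite -mulrA -mulrDr ler_wpM2l ?sqr_ge0 //. lra.
Qed.

(* [pweight q th x i] is the weight of the i-th odd element of a block whose
   x-th odd element is the heavy one. *)
Definition pweight (q : nat) (th : R) (x i : nat) : R :=
  1 + th * (q%:R * (i == x)%:R - 1).
Definition block q th x : seq R := [seq pweight q th x i | i <- iota 0 q].
Definition odd_weights q th (z : seq nat) : seq R :=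
  flatten [seq block q th x | x <- z].
(** The entries of v go to odd elements; even elements keep weight 1, as [unif_on_evens] demands. *)
Definition interleave (v : seq R) : seq R := flatten [seq [:: y; 1] | y <- v].

(** The trace argument uses q = 3: a block is an interval of six elements and has mass 6. *)
Definition base_block : seq bool -> R := ps true (interleave (nseq 3 1)).
Definition one_block th x : seq bool -> R := ps true (interleave (block 3 th x)).
Definition mixed_block th w : R := 3^-1 * \sum_(x <- iota 0 3) one_block th x w.

Lemma interleave_cat v v' : interleave (v ++ v') = interleave v ++ interleave v'.
Proof. by rewrite /interleave map_cat flatten_cat. Qed.

Lemma size_interleave v : size (interleave v) = (size v).*2.
Proof. by elim: v => //= y v; rewrite /interleave /= => ->. Qed.

Lemma sum_interleave v : \sum_(a <- interleave v) a = \sum_(y <- v) y + (size v)%:R.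
Proof.
elim: v => [|y v]; first by rewrite !big_nil addr0.
rewrite /interleave /= !big_cons => ->; rewrite -natr1; ring.
Qed.

Lemma all_block_ge0 th x a : 0 <= th <= 1 -> a \in interleave (block 3 th x) -> 0 <= a.
Proof.
move=> /andP[th0 th1] /flatten_mapP[y /mapP[i _ ->]]; rewrite !inE.
case/orP => /eqP-> //; rewrite /pweight; case: (i == x) => /=; lra.
Qed.

Lemma ones_ge0 n (a : R) : a \in interleave (nseq n 1) -> 0 <= a.
Proof.
by move=> /flatten_mapP[y /nseqP[-> _]]; rewrite !inE => /orP[] /eqP->.
Qed.

Lemma one_block_ge0 th x w : 0 <= th <= 1 -> 0 <= one_block th x w.
Proof. by move=> h; apply: ps_ge0 => a /all_block_ge0; apply. Qed.

Lemma base_block_ge0 w : 0 <= base_block w.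
Proof. by apply: ps_ge0 => a; exact: ones_ge0. Qed.

Lemma mixed_block_ge0 th w : 0 <= th <= 1 -> 0 <= mixed_block th w.
Proof.
by move=> h; rewrite mulr_ge0 ?invr_ge0 // sumr_ge0 // => x _; exact: one_block_ge0.
Qed.

Lemma has_mass_base_block : has_mass base_block 6.
Proof.
have := has_mass_ps true (interleave (nseq 3 (1 : R))).
rewrite sum_interleave /= !big_cons big_nil; congr (has_mass _ _); lra.
Qed.

Lemma has_mass_one_block th x : (x < 3)%N -> has_mass (one_block th x) 6.
Proof.
move=> x3; have := has_mass_ps true (interleave (block 3 th x)).
rewrite sum_interleave /= !big_cons big_nil /pweight; congr (has_mass _ _).
by case: x x3 => [|[|[|x]]] // _ /=; lra.
Qed.

Lemma has_mass_mixed_block th : has_mass (mixed_block th) 6.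
Proof.
move=> k; rewrite -mulr_sumr exchange_big /= !big_cons big_nil.
by rewrite !has_mass_one_block //; lra.
Qed.

(** Sample by sample, the terms linear in th cancel in the average over the heavy position, and
    [first_order_prod] bounds the remainder. *)
Lemma rel_close_mixed_block th : 0 <= th <= 1 -> rel_close (th ^+ 2) (mixed_block th) base_block.
Proof.
move=> th01 w.
(* The derivative in th of the weight at index i; odd indices are even elements. *)
pose beta x i : R := if odd i then 0 else 3 * (i./2 == x)%:R - 1.
have f0 : 0 < (size w)`!%:R :> R by rewrite ltr0n fact_gt0.
have psE (a : nat -> R) s : s = [seq a x | x <- iota 0 6] ->
  (size w)`!%:R * ps true s w = \sum_(t <- lists (size w) (iota 0 6))
    (\prod_(x <- t) a x) * (trace_of t == w)%:R.
  move=> ->; have := lists_trace_ps a 0 6 (size w) (fun u => (u == w)%:R).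
  by rewrite sum_words_pick => ->.
have E0 : (size w)`!%:R * base_block w = \sum_(t <- lists (size w) (iota 0 6))
    (\prod_(y <- t) 1) * (trace_of t == w)%:R by exact: (psE (fun=> 1)).
have Ex x := psE (fun i => 1 + th * beta x i) (interleave (block 3 th x)).
have {}Ex x : (size w)`!%:R * one_block th x w = \sum_(t <- lists (size w) (iota 0 6))
    (\prod_(y <- t) (1 + th * beta x y)) * (trace_of t == w)%:R.
  apply: (Ex x); rewrite /interleave /= /pweight /beta /=.
  by rewrite mulr0 addr0.
have EG : (size w)`!%:R * mixed_block th w = \sum_(t <- lists (size w) (iota 0 6))
    3^-1 * \sum_(x <- iota 0 3) (\prod_(y <- t) (1 + th * beta x y)) *
      (trace_of t == w)%:R.
  rewrite -mulr_sumr exchange_big /mixed_block mulrCA mulr_sumr; congr (_ * _).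
  by apply: eq_bigr => x _; rewrite Ex.
rewrite -(ler_pM2l f0) -[X in X * `|_|](ger0_norm (ltW f0)) -normrM mulrBr.
rewrite (mulrCA _ (_ * _) (base_block w)) EG !E0.
rewrite -sumrB mulr_sumr.
apply: le_trans (ler_norm_sum _ _ _) _.
rewrite big_seq [leRHS]big_seq; apply: ler_sum => t tL.
rewrite -mulr_suml mulrA -mulrBl normrM [X in _ * X]ger0_norm ?ler0n //.
rewrite mulrA ler_wpM2r ?ler0n // big1_eq mulr1.
rewrite -(size_lists tL).
have hb x y : `|beta x y| <= 2.
  rewrite /beta; case: odd; first by rewrite normr0.
  by rewrite ler_norml; case: (_ == _) => /=; lra.
have hx x := first_order_prod t th01 (hb x).
(* At an odd element the three slopes are 2, -1, -1 in some order. *)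
have lin : \sum_(y <- t) beta 0 y + \sum_(y <- t) beta 1 y + \sum_(y <- t) beta 2 y = 0.
  rewrite -!big_split big_seq big1 // => y /(mem_lists tL).
  by rewrite /beta !inE => /or4P[|||/orP[|/orP[]]] // /eqP-> /=; lra.
have := hx 0; have := hx 1; have := hx 2.
rewrite !big_cons big_nil addr0 !ler_norml.
have : th * (\sum_(y <- t) beta 0 y) + th * (\sum_(y <- t) beta 1 y) +
   th * (\sum_(y <- t) beta 2 y) = 0 by rewrite -!mulrDr lin mulr0.
by move=> ? /andP[? ?] /andP[? ?] /andP[? ?]; apply/andP; split; lra.
Qed.

Lemma lexp_short b (a : R) : (lexp b a [::] = 1) *
  (forall c, lexp b a [:: c] = (c == b)%:R * a) *
  (forall c d, lexp b a [:: c; d] = ((c == b) && (d == b))%:R * (a ^+ 2 / 2)).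
Proof.
by rewrite /lexp /eser /= fact0 factS fact0 expr0 expr1 !divr1 mul1r;
  do 2?split => // *; rewrite ?andbT // divr1.
Qed.

(** A word with two different letters has a coefficient linear in the odd weights, restored by
    averaging; X_1 X_1 has half the square of the fixed total odd weight. *)
Lemma mixed_block_short th w : (size w <= 2)%N -> mixed_block th w = base_block w.
Proof.
rewrite /mixed_block /base_block !big_cons big_nil addr0 /one_block /interleave /block /pweight /=.
case: w => [|a [|b [|c w]]] // _.
- by rewrite /= !lexp_short /ser1 /=; lra.
- by case: a; rewrite /= !lexp_short /ser1 /=; lra.
- by case: a; case: b; rewrite /= !lexp_short /ser1 /=; field.
Qed.

End Block.

(** * Relative change of a superblock *)

Section Superblock.

Variable R : realType.
Implicit Types (F G U : seq bool -> R) (w : seq bool) (th : R).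

Lemma base_block_le w : base_block R w <= eser 6 w.
Proof.
apply: le_trans (ps_le _ _ _) _; first by move=> a; exact: ones_ge0.
rewrite (_ : \sum_(a <- interleave (nseq 3 (1 : R))) a = 6) // sum_interleave /= !big_cons big_nil.
by lra.
Qed.

Lemma eserM a k w : eser (k * a) w = k ^+ size w * eser a w :> R.
Proof. by rewrite /eser exprMn mulrA. Qed.

Lemma pow5_ge1 k : 1 <= 5 ^+ k :> R.
Proof. by rewrite exprn_ege1 // ler1n. Qed.

(** 30 is the growth rate 5 of [rel_close] times the block mass 6. *)
Lemma mixed_block_le th w : 0 <= th <= 1 -> mixed_block th w <= eser 30 w.
Proof.
move=> th01; have := rel_close_mixed_block th01 w.
have g0 := base_block_ge0 R w; have p1 := pow5_ge1 (size w).
have -> : 30 = 5 * 6 :> R by lra.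
rewrite eserM => h; apply: (@le_trans _ _ (5 ^+ size w * base_block R w)); last first.
  by rewrite ler_wpM2l ?base_block_le // (le_trans _ p1).
have t1 : th ^+ 2 <= 1 by case/andP: th01 => ? ?; rewrite expr_le1.
have : th ^+ 2 * (5 ^+ size w - 1) * base_block R w <= 1 * (5 ^+ size w - 1) * base_block R w.
  by rewrite ler_wpM2r // ler_wpM2r // subr_ge0.
have := ler_norm (mixed_block th w - base_block R w); lra.
Qed.

Lemma iter_conv_le F a n w : (forall u, 0 <= F u) -> 0 <= a ->
  (forall u, F u <= eser a u) -> iter n (conv F) (ser1 R) w <= eser (n%:R * a) w.
Proof.
move=> F0 a0 Fa; elim: n w => [|n IH] w.
  rewrite mul0r /= /ser1 /eser; case: w => [|x w]; first by rewrite fact0 divr1.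
  by rewrite expr0n mul0r.
rewrite iterS -natr1 mulrDl mul1r addrC -conv_eser.
by apply: conv_le => // u; apply: iter_conv_ge0 => // v; rewrite ler0n.
Qed.

(** The difference vanishes on words shorter than 3, and on the others B to the length is at least
    B^3. This gains the factor B^-3 at the price of the larger mass 30 B. *)
Lemma mixed_block_diff th (B : nat) w : 0 <= th <= 1 -> (0 < B)%N ->
  `|mixed_block th w - base_block R w| <= th ^+ 2 / B%:R ^+ 3 * eser (30 * B%:R) w.
Proof.
move=> th01 B0; have B1 : 1 <= B%:R :> R by rewrite ler1n.
have Bp : 0 < B%:R :> R by rewrite ltr0n.
have [/mixed_block_short ->|w3] := leqP (size w) 2.
  by rewrite subrr normr0 mulr_ge0 ?eser_ge0 ?divr_ge0 ?sqr_ge0 ?exprn_ge0 ?mulr_ge0.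
apply: le_trans (rel_close_mixed_block th01 w) _.
rewrite -mulrA -[leRHS]mulrA ler_wpM2l ?sqr_ge0 //.
apply: (@le_trans _ _ (eser 30 w)).
  have -> : 30 = 5 * 6 :> R by lra.
  rewrite eserM. rewrite ler_pM ?base_block_ge0 ?base_block_le ?subr_ge0 ?pow5_ge1 //.
  by rewrite gerBl.
rewrite mulrC [30 * _]mulrC eserM mulrAC.
rewrite -[X in X <= _]mul1r ler_wpM2r ?eser_ge0 //.
rewrite ler_pdivlMr ?exprn_gt0 // mul1r ler_weXn2l //.
Qed.

(** Telescoping: the blocks are exchanged one at a time, and the remaining ones are dominated by
    [eser 30]. *)
Lemma iter_mixed_block_diff th (B b : nat) w : 0 <= th <= 1 -> (0 < B)%N ->
  `|iter b (conv (mixed_block th)) (ser1 R) w - iter b (conv (base_block R)) (ser1 R) w| <=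
  b%:R * (th ^+ 2 / B%:R ^+ 3) * eser (30 * B%:R + 30 * b%:R) w.
Proof.
move=> th01 B0; set e := th ^+ 2 / _.
have e0 : 0 <= e by rewrite divr_ge0 ?sqr_ge0 ?exprn_ge0.
elim: b w => [|b IH] w; first by rewrite subrr normr0 !mul0r.
pose Gb := iter b (conv (mixed_block th)) (ser1 R).
pose G0b := iter b (conv (base_block R)) (ser1 R).
have -> : iter b.+1 (conv (mixed_block th)) (ser1 R) w - iter b.+1 (conv (base_block R)) (ser1 R) w =
  conv (fun u => mixed_block th u - base_block R u) Gb w + conv (base_block R) (fun u => Gb u - G0b u) w.
  by rewrite convBl convBr /= -/Gb -/G0b; lra.
have m30 u : base_block R u <= eser 30 u.
  by apply: le_trans (base_block_le u) _; apply: ler_eser; lra.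
have b1 : `|conv (fun u => mixed_block th u - base_block R u) Gb w| <=
    e * eser (30 * B%:R + 30 * b.+1%:R) w.
  apply: le_trans (@conv_norm _ _ (fun u => e * eser (30 * B%:R) u) _
    (eser (b%:R * 30)) w _ _) _.
  - by move=> u; exact: mixed_block_diff.
  - move=> u; rewrite ger0_norm; first apply: iter_conv_le => // v.
    + exact: mixed_block_ge0.
    + exact: mixed_block_le.
    + apply: iter_conv_ge0 => v; rewrite ?ler0n //; exact: mixed_block_ge0.
  - rewrite convZl conv_eser ler_wpM2l //; apply: ler_eser.
      by rewrite addr_ge0 // mulr_ge0.
    by rewrite lerD2l mulrC ler_wpM2l // ler_nat.
have b2 : `|conv (base_block R) (fun u => Gb u - G0b u) w| <=
    b%:R * e * eser (30 * B%:R + 30 * b.+1%:R) w.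
  apply: le_trans (@conv_norm _ _ (eser 30) _ (fun u => b%:R * e *
    eser (30 * B%:R + 30 * b%:R) u) w _ IH) _.
    by move=> u; rewrite ger0_norm ?base_block_ge0.
  rewrite convZr conv_eser (_ : 30 + _ = 30 * B%:R + 30 * b.+1%:R) //.
  by rewrite -(natr1 b); ring.
apply: le_trans (ler_normD _ _) _; apply: le_trans (lerD b1 b2) _.
by rewrite -mulrDl -(natr1 b) [(b%:R + 1) * e]mulrDl mul1r addrC.
Qed.

(* [exp X_1 exp X_0] dominates [1 + X_1 + X_0], whose n-th power has the
   coefficient ['C(n, size w)] at every word [w]. *)
Lemma binomial_le_conv F n w : (forall u, 'C(n, size u)%:R <= F u) ->
  'C(n.+1, size w)%:R <= conv (lexp true 1) (conv (lexp false 1) F) w.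
Proof.
move=> nF; have F0 u : 0 <= F u by apply: le_trans (nF u); rewrite ler0n.
have l0 b u : 0 <= lexp b 1 u :> R by rewrite lexp_ge0.
have step b (H : seq bool -> R) u : (forall v, 0 <= H v) ->
    H u + (if u is x :: u' then (x == b)%:R * H u' else 0) <= conv (lexp b 1) H u.
  move=> H0; case: u => [|x u] /=; rewrite !lexp_short mul1r // lerD2l.
  case: u => [|y u] /=; rewrite lexp_short mulr1 ?addr0 // lerDl.
  by rewrite conv_ge0 // => v.
have C0 u : 0 <= conv (lexp false 1) F u by rewrite conv_ge0.
apply: le_trans (step true _ w C0).
case: w => [|x w].
  rewrite addr0; apply: le_trans (step false F [::] F0).
  by rewrite addr0 bin0 (le_trans _ (nF [::])) // bin0.
have := step false F (x :: w) F0; have := step false F w F0.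
move: (conv (lexp false 1) F) {C0} => H.
have e0 : 0 <= (if w is y :: u then (y == false)%:R * F u else 0).
  by case: (w) => // y v; rewrite mulr_ge0.
move: (if w is _ :: _ then _ else _) e0 => e e0 hw hxw.
have := nF (x :: w); have := nF w; rewrite /= binS natrD.
by case: x hxw => /=; lra.
Qed.

Lemma binomial_le_iter_base_block B w :
  'C(3 * B, size w)%:R <= iter B (conv (base_block R)) (ser1 R) w.
Proof.
elim: B w => [|B IH] w.
  by rewrite muln0 /= /ser1; case: w => [|x w] //=; rewrite bin0n.
rewrite iterS mulnS /base_block /interleave /=.
set F := iter B _ _ in IH *.
have -> : conv (conv (lexp true 1) (conv (lexp false 1) (conv (lexp true 1)
  (conv (lexp false 1) (conv (lexp true 1) (conv (lexp false 1) (ser1 R))))))) F w =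
  conv (lexp true 1) (conv (lexp false 1) (conv (lexp true 1)
  (conv (lexp false 1) (conv (lexp true 1) (conv (lexp false 1) F))))) w.
  do 6![rewrite -convA; apply: eq_conv => // {}w]; exact: conv1s.
by apply: binomial_le_conv => u; apply: binomial_le_conv => v;
  exact: binomial_le_conv.
Qed.

(** Each factor of the falling factorial of 3 B is at least 2 B as long as there are at most B
    factors. *)
Lemma eser_le_binomial B w : (size w <= B)%N ->
  eser (2 * B%:R) w <= 'C(3 * B, size w)%:R :> R.
Proof.
move=> wB; rewrite /eser ler_pdivrMr ?ltr0n ?fact_gt0 //.
rewrite -natrM -natrX -natrM ler_nat bin_ffact.
elim: (size w) wB => // k IH kB; rewrite ffactnSr expnSr leq_mul //.
  by apply: IH; exact: ltnW.
lia.
Qed.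

(** For words of length k <= B the absolute bound with mass 60 B = 30 * 2 B is compared with the
    lower bound 'C(3 B, k) on the base series. For k > B the relation [rel_close] is enough, because
    B^2 <= 4^k <= 6^k. *)
Lemma superblock_close th (B : nat) w : 0 <= th <= 1 -> (0 < B)%N ->
  `|iter B (conv (mixed_block th)) (ser1 R) w - iter B (conv (base_block R)) (ser1 R) w| <=
  th ^+ 2 / B%:R ^+ 2 * 30 ^+ size w * iter B (conv (base_block R)) (ser1 R) w.
Proof.
move=> th01 B0; have Bp : 0 < B%:R :> R by rewrite ltr0n.
have S0 u : 0 <= iter B (conv (base_block R)) (ser1 R) u.
  by apply: iter_conv_ge0 => v; [exact: base_block_ge0|rewrite ler0n].
have [wB|Bw] := leqP (size w) B.
  apply: le_trans (iter_mixed_block_diff _ _ th01 B0) _.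
  have -> : B%:R * (th ^+ 2 / B%:R ^+ 3) = th ^+ 2 / B%:R ^+ 2 :> R.
    by field; rewrite gt_eqF.
  rewrite -[leRHS]mulrA ler_wpM2l ?divr_ge0 ?sqr_ge0 ?exprn_ge0 //.
  have -> : 30 * B%:R + 30 * B%:R = 30 * (2 * B%:R) :> R by ring.
  rewrite eserM ler_wpM2l ?exprn_ge0 //.
  exact: le_trans (eser_le_binomial wB) (binomial_le_iter_base_block _ _).
have t01 : 0 <= th ^+ 2 <= 1.
  by case/andP: th01 => ? ?; rewrite sqr_ge0 expr_le1.
apply: le_trans (rel_close_iter B t01 (@base_block_ge0 R) (rel_close_mixed_block th01) w) _.
rewrite ler_wpM2r // -[leRHS]mulrA ler_wpM2l ?sqr_ge0 //.
rewrite mulrC ler_pdivlMr ?exprn_gt0 //.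
have -> : 30 = 5 * 6 :> R by lra.
rewrite exprMn ler_pM ?subr_ge0 ?pow5_ge1 ?exprn_ge0 //; first by rewrite gerBl.
rewrite -!natrX ler_nat.
apply: (@leq_trans ((2 ^ size w) ^ 2)).
  by rewrite leq_exp2r // ltnW // (ltn_trans Bw) // ltn_expl.
by rewrite -expnM mulnC expnM leq_exp2r // (leq_ltn_trans _ Bw).
Qed.

End Superblock.

(** * The perturbed distributions *)

Section Perturbation.

Variable R : realType.
Implicit Types (th : R).

Definition weights q th (z : seq nat) : seq R := interleave (odd_weights q th z).
(** The default 1 is the weight of the elements beyond the last block. *)
Definition weight q th (z : seq nat) (i : nat) : R := nth 1 (weights q th z) i.
Definition perturbed n q th (z : seq nat) (i : 'I_(2 * n)) : R :=
  weight q th z i / (2 * n)%:R.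

Lemma map_nth_pad (T : Type) (x0 : T) (s : seq T) N : (size s <= N)%N ->
  [seq nth x0 s i | i <- iota 0 N] = s ++ nseq (N - size s) x0.
Proof.
move=> sN; apply: (@eq_from_nth _ x0).
  by rewrite size_map size_iota size_cat size_nseq subnKC.
move=> i; rewrite size_map size_iota => iN.
rewrite (nth_map 0) ?size_iota // nth_iota // add0n nth_cat nth_nseq.
by case: ltnP => // si; rewrite nth_default // if_same.
Qed.

Lemma sum_nth_pad (T : Type) (x0 : T) (s : seq T) N (phi : T -> R) :
  (size s <= N)%N ->
  \sum_(i <- iota 0 N) phi (nth x0 s i) =
  \sum_(y <- s) phi y + (N - size s)%:R * phi x0.
Proof.
move=> sN; rewrite -(big_map (nth x0 s) xpredT) map_nth_pad // big_cat /=.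
by rewrite big_nseq iter_addr_0 mulr_natl.
Qed.

Lemma sum_interleave_map (phi : R -> R) v :
  \sum_(a <- interleave v) phi a = \sum_(y <- v) phi y + (size v)%:R * phi 1.
Proof.
elim: v => [|y v]; first by rewrite !big_nil mul0r addr0.
rewrite /interleave /= !big_cons => ->; rewrite -(natr1 (size v)); ring.
Qed.

Lemma sum_pick (q x : nat) (g : nat -> R) : (x < q)%N ->
  \sum_(i <- iota 0 q) (i == x)%:R * g i = g x.
Proof.
move=> xq; rewrite (bigD1_seq x) ?mem_iota ?iota_uniq //= eqxx mul1r.
by rewrite big1 ?addr0 // => i /negbTE ->; rewrite mul0r.
Qed.

Lemma sum_iota_const q (c : R) : \sum_(i <- iota 0 q) c = q%:R * c.
Proof. by rewrite big_const_seq count_predT size_iota iter_addr_0 mulr_natl. Qed.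

Lemma sum_block q th x : (x < q)%N -> \sum_(y <- block q th x) y = q%:R.
Proof.
move=> xq; rewrite big_map /pweight.
under eq_bigr => i _.
  rewrite (_ : 1 + _ = (1 - th) + (i == x)%:R * (th * q%:R)); last by ring.
  over.
by rewrite big_split /= sum_iota_const (sum_pick (fun=> th * q%:R)) //; ring.
Qed.

Lemma sum_block_dist q th x : 0 <= th -> (x < q)%N ->
  \sum_(y <- block q th x) `|y - 1| = 2 * th * (q%:R - 1).
Proof.
move=> th0 xq; rewrite big_map /pweight.
have q1 : 1 <= q%:R :> R by rewrite ler1n (leq_ltn_trans _ xq).
under eq_bigr => i _.
  rewrite (_ : `|_| = th + (i == x)%:R * (th * (q%:R - 2))); last first.
    rewrite addrAC subrr add0r normrM ger0_norm //.
    case: (i == x) => /=; rewrite ?mulr1 ?mulr0 ?sub0r ?normrN ?normr1.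
      by rewrite ger0_norm ?subr_ge0 //; ring.
    by ring.
  over.
by rewrite big_split /= sum_iota_const (sum_pick (fun=> th * (q%:R - 2))) //; ring.
Qed.

Lemma sum_block_mul q th x x' : (x < q)%N -> (x' < q)%N ->
  \sum_(i <- iota 0 q) (pweight q th x i - 1) * (pweight q th x' i - 1) =
  th ^+ 2 * (q%:R ^+ 2 * (x == x')%:R - q%:R).
Proof.
move=> xq xq'; rewrite /pweight.
under eq_bigr => i _.
  rewrite (_ : _ * _ = th ^+ 2 + (i == x)%:R * (th ^+ 2 * (q%:R ^+ 2 * (i == x')%:R - q%:R))
    + (i == x')%:R * (- (th ^+ 2 * q%:R))); last by ring.
  over.
rewrite !big_split /= sum_iota_const.
rewrite (sum_pick (fun i => th ^+ 2 * (q%:R ^+ 2 * (i == x')%:R - q%:R))) //.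
by rewrite (sum_pick (fun=> - (th ^+ 2 * q%:R))) //; ring.
Qed.

Lemma size_odd_weights q th z : size (odd_weights q th z) = (size z * q)%N.
Proof.
elim: z => //= x z IH; rewrite /odd_weights /= size_cat size_map size_iota.
by rewrite -/(odd_weights q th z) IH mulSn.
Qed.

Lemma size_weights q th z : size (weights q th z) = (2 * (size z * q))%N.
Proof. by rewrite size_interleave size_odd_weights mul2n. Qed.

Lemma sum_odd_weights q th z (phi : R -> R) (c : R) :
  (forall x, (x < q)%N -> \sum_(y <- block q th x) phi y = c) ->
  {in z, forall x, (x < q)%N} ->
  \sum_(y <- odd_weights q th z) phi y = (size z)%:R * c.
Proof.
move=> hc; elim: z => [|x z IH] hz; first by rewrite big_nil mul0r.
rewrite /odd_weights /= big_cat /= -/(odd_weights q th z) hc ?IH.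
- by rewrite -(natr1 (size z)); ring.
- by move=> y yz; apply: hz; rewrite inE yz orbT.
- by rewrite hz // inE eqxx.
Qed.

Lemma sum_weight q th z n : (size z * q <= n)%N -> {in z, forall x, (x < q)%N} ->
  \sum_(i <- iota 0 (2 * n)) weight q th z i = (2 * n)%:R.
Proof.
move=> zn hz; rewrite (sum_nth_pad _ id) ?size_weights ?leq_mul2l //.
rewrite (sum_interleave_map id) (sum_odd_weights (phi := id) (c := q%:R)) //.
  rewrite size_odd_weights natrB ?leq_mul2l // !natrM; ring.
by move=> x; exact: sum_block.
Qed.

Lemma sum_weight_dist q th z n : 0 <= th ->
  (size z * q <= n)%N -> {in z, forall x, (x < q)%N} ->
  \sum_(i <- iota 0 (2 * n)) `|weight q th z i - 1| =
  (size z)%:R * (2 * th * (q%:R - 1)).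
Proof.
move=> th0 zn hz.
rewrite (sum_nth_pad _ (fun y => `|y - 1|)) ?size_weights ?leq_mul2l //.
rewrite (sum_interleave_map (fun y => `|y - 1|)) subrr normr0 !mulr0 !addr0.
by apply: sum_odd_weights => // x; exact: sum_block_dist.
Qed.

(** These inner products govern the second moment. Only odd elements inside blocks deviate from 1,
    and the summand of each block averages to 0 over independent heavy positions. *)
Lemma sum_weight_mul q th z z' n : size z = size z' ->
  (size z * q <= n)%N -> {in z, forall x, (x < q)%N} -> {in z', forall x, (x < q)%N} ->
  \sum_(i <- iota 0 (2 * n)) weight q th z i * weight q th z' i =
  (2 * n)%:R +
  \sum_(p <- zip z z') th ^+ 2 * (q%:R ^+ 2 * (p.1 == p.2)%:R - q%:R).
Proof.
move=> zz' zn hz hz'; have zn' : (size z' * q <= n)%N by rewrite -zz'.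
pose phi (p : R * R) := (p.1 - 1) * (p.2 - 1).
have sizeE : size (weights q th z) = size (weights q th z').
  by rewrite !size_weights zz'.
have E : \sum_(i <- iota 0 (2 * n)) (weight q th z i - 1) * (weight q th z' i - 1) =
    \sum_(p <- zip (weights q th z) (weights q th z')) phi p.
  rewrite (eq_bigr (fun i => phi (nth (1, 1) (zip (weights q th z) (weights q th z')) i))).
    rewrite (sum_nth_pad (1, 1)); first by rewrite /phi /= subrr mul0r mulr0 addr0.
    by rewrite size_zip -sizeE minnn size_weights leq_mul2l.
  by move=> i _; rewrite nth_zip.
have int (v v' : seq R) : size v = size v' ->
    \sum_(p <- zip (interleave v) (interleave v')) phi p = \sum_(p <- zip v v') phi p.
  elim: v v' => [|y v IH] [|y' v'] //= [/IH e].
  by rewrite /interleave /= !big_cons e /phi /= subrr mul0r add0r.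
have odd' : \sum_(p <- zip (odd_weights q th z) (odd_weights q th z')) phi p =
    \sum_(p <- zip z z') th ^+ 2 * (q%:R ^+ 2 * (p.1 == p.2)%:R - q%:R).
  elim: z z' zz' hz hz' {zn zn' sizeE E} => [|x z IH] [|x' z'] //=.
    by rewrite !big_nil.
  move=> [zz'] hz hz'; rewrite /odd_weights /= zip_cat ?size_map // big_cat big_cons /=.
  rewrite -!/(odd_weights _ _ _) IH //.
  - congr (_ + _); rewrite -sum_block_mul.
    + by rewrite zip_map big_map.
    + by rewrite hz // inE eqxx.
    + by rewrite hz' // inE eqxx.
  - by move=> y yz; apply: hz; rewrite inE yz orbT.
  - by move=> y yz; apply: hz'; rewrite inE yz orbT.
rewrite -odd' -int ?size_odd_weights ?zz' // -E.
rewrite (eq_bigr (fun i => (weight q th z i - 1) * (weight q th z' i - 1) +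
   (weight q th z i + weight q th z' i - 1))); last by move=> i _; ring.
rewrite big_split sumrB big_split /= sum_weight // sum_weight // sum_iota_const.
by ring.
Qed.

Lemma weight_ge0 q th z i : 0 <= th <= 1 -> 0 <= weight q th z i.
Proof.
move=> /andP[th0 th1]; rewrite /weight.
have [iz|iz] := ltnP i (size (weights q th z)); last by rewrite nth_default.
have /flatten_mapP[y yz] := mem_nth 1 iz; rewrite !inE => /orP[]/eqP -> //.
move: yz => /flatten_mapP[x _ /mapP[j _ ->]]; rewrite /pweight.
have q0 : 0 <= q%:R :> R by []; have j0 : 0 <= (j == x)%:R :> R by [].
have : 0 <= th * (q%:R * (j == x)%:R) by rewrite !mulr_ge0.
lra.
Qed.

Lemma weight_even q th z i : odd i -> weight q th z i = 1.
Proof.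
rewrite /weight /weights; elim: (odd_weights q th z) i => [|y v IH] [|[|i]] //=.
by rewrite negbK => /IH.
Qed.

(** Each block deviates by 2 th (q - 1) in l1 norm before scaling, so the total variation distance
    is [size z] times th (q - 1) / (2 n). *)
Lemma perturbed_in_class q th z n eps : (0 < n)%N -> 0 <= th <= 1 ->
  (size z * q <= n)%N -> {in z, forall x, (x < q)%N} ->
  eps * (2 * n)%:R < (size z)%:R * (th * (q%:R - 1)) ->
  (@far_from_unif R (2 * n) eps `&` @unif_on_evens R (2 * n))%classic
    (@perturbed n q th z).
Proof.
move=> n0 th01 zn hz heps; have N0 : 0 < (2 * n)%:R :> R by rewrite ltr0n muln_gt0.
have ordE (F : nat -> R) : \sum_(i < 2 * n) F i = \sum_(i <- iota 0 (2 * n)) F i.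
  have -> : iota 0 (2 * n) = index_iota 0 (2 * n) by rewrite /index_iota subn0.
  by rewrite big_mkord.
split; first split; first split.
- by move=> i; rewrite divr_ge0 ?weight_ge0 // ltW.
- rewrite (ordE (fun i => weight q th z i / (2 * n)%:R)) -mulr_suml sum_weight //.
  by rewrite mulfV // gt_eqF.
- rewrite /tv /perturbed /unif.
  rewrite (ordE (fun i => `|weight q th z i / (2 * n)%:R - (2 * n)%:R^-1|)).
  under eq_bigr => i _.
    rewrite -[X in _ - X]mul1r -mulrBl normrM (ger0_norm (_ : 0 <= (2 * n)%:R^-1)).
      over.
    by rewrite invr_ge0 ltW.
  rewrite -mulr_suml sum_weight_dist //; last by case/andP: th01.
  by rewrite [X in _ < X]mulrA ltr_pdivlMr //; lra.
- by move=> i; rewrite /elt /= negbK => ei; rewrite /perturbed weight_even // mul1r.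
Qed.

(** For weights of average 1 and f the acceptance function, this is N^m times the acceptance
    probability. *)
Definition sample_sum N m (a : nat -> R) (f : seq bool -> R) : R :=
  \sum_(t <- lists m (iota 0 N)) (\prod_(x <- t) a x) * f (trace_of t).

Lemma samp_expect_scaled (N m : nat) (a : nat -> R) (f : seq bool -> R) :
  samp_expect (fun i : 'I_N => a i / N%:R) m (fun S => f (trace S)) =
  sample_sum N m a f / N%:R ^+ m.
Proof.
rewrite (samp_expect_lists N m (fun i => a i / N%:R)) /sample_sum mulr_suml.
rewrite big_seq [RHS]big_seq; apply: eq_bigr => t /size_lists st.
rewrite big_split /= mulrAC; congr (_ * _ * _).
by rewrite big_const_seq count_predT st -exprVn -Monoid.iteropE.
Qed.

(** 1/50 is 2 * 51/100 - 1, scaled here by (2 n)^m. *)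
Lemma tester_gap n m eps (A : seq bool -> R) q th z : (0 < n)%N ->
  is_tester [set @unif R (2 * n)]
    (@far_from_unif R (2 * n) eps `&` @unif_on_evens R (2 * n)) (51 / 100) m A ->
  0 <= th <= 1 -> (size z * q <= n)%N -> {in z, forall x, (x < q)%N} ->
  eps * (2 * n)%:R < (size z)%:R * (th * (q%:R - 1)) ->
  1 / 50 * (2 * n)%:R ^+ m <=
  sample_sum (2 * n) m (fun=> 1) A - sample_sum (2 * n) m (weight q th z) A.
Proof.
move=> n0 [A01 h1 h2] th01 zn hz heps.
have N0 : 0 < (2 * n)%:R :> R by rewrite ltr0n muln_gt0.
have {}h1 := h1 _ erefl.
have {}h2 := h2 _ (perturbed_in_class n0 th01 zn hz heps).
have e1 : samp_expect (@unif R (2 * n)) m (fun S => A (trace S)) =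
    sample_sum (2 * n) m (fun=> 1) A / (2 * n)%:R ^+ m.
  rewrite -samp_expect_scaled /samp_expect; apply: eq_bigr => t _.
  by congr (_ * _); apply: eq_bigr => j _; rewrite mul1r.
have e2 : samp_expect (@perturbed n q th z) m (fun S => 1 - A (trace S)) =
    1 - sample_sum (2 * n) m (weight q th z) A / (2 * n)%:R ^+ m.
  rewrite (samp_expect_scaled (2 * n) m (weight q th z) (fun w => 1 - A w)).
  rewrite /sample_sum; under eq_bigr do rewrite mulrBr mulr1.
  rewrite sumrB sum_lists_prod sum_weight // mulrBl mulfV //.
  by rewrite expf_neq0 // gt_eqF.
have Nm0 : 0 < (2 * n)%:R ^+ m :> R by rewrite exprn_gt0.
rewrite -ler_pdivlMr // mulrBl; move: h1 h2; rewrite e1 e2; lra.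
Qed.

End Perturbation.

(** * Lower bounds *)

Section Bounds.

Variable R : realType.
Implicit Types (th : R).

Lemma pow_1D_le (m : nat) (x : R) : 0 <= x -> m%:R * x <= 1 / 2 ->
  (1 + x) ^+ m <= 1 + 2 * (m%:R * x).
Proof.
move=> x0 mx; have := @prod_1D_le R (nseq m 0%N) (fun=> x) (fun=> x0).
rewrite !big_const_seq !count_predT size_nseq iter_addr_0 -Monoid.iteropE.
by rewrite -[x *+ m]mulr_natl; apply.
Qed.

(** exp x <= 1 / (1 - x), and the right side times 1 - x is 1 + x^2 (1 - 2 x). *)
Lemma expR_le (x : R) : x <= 1 / 2 -> expR x <= 1 + x + 2 * x ^+ 2.
Proof.
move=> x2; have h := expR_ge1Dx (- x); have e0 := expR_gt0 x.
have : expR x * (1 - x) <= 1.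
  by rewrite -[leRHS](expRxMexpNx_1 x) ler_wpM2l // ltW.
have p1 : 0 < 1 - x by lra.
rewrite -ler_pdivlMr // mul1r => /le_trans; apply.
rewrite -[leLHS]mul1r ler_pdivrMr //.
rewrite -subr_ge0 (_ : _ - 1 = x ^+ 2 * (1 - 2 * x)); last by ring.
by rewrite mulr_ge0 ?sqr_ge0 //; lra.
Qed.

Lemma sum_pairs_prod (T : Type) K (L : seq T) (g : T * T -> R) :
  \sum_(z <- lists K L) \sum_(z' <- lists K L) \prod_(p <- zip z z') g p =
  (\sum_(x <- L) \sum_(x' <- L) g (x, x')) ^+ K.
Proof.
elim: K => [|K IH]; first by rewrite !big_lists0 big_nil.
rewrite big_listsS exprS -IH mulr_suml; apply: eq_bigr => x _.
rewrite mulr_sumr; apply: eq_bigr => z _.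
rewrite big_listsS mulr_suml; apply: eq_bigr => x' _.
by rewrite mulr_sumr; apply: eq_bigr => z' _; rewrite /= big_cons.
Qed.

(** Over all pairs the exponents sum to 0 and their squares to q^4 (q - 1) kappa^2, which [expR_le]
    doubles. *)
Lemma sum_pairs_expR q (kappa : R) : (0 < q)%N -> 0 <= kappa ->
  kappa * (q%:R ^+ 2 - q%:R) <= 1 / 2 ->
  \sum_(x <- iota 0 q) \sum_(x' <- iota 0 q)
     expR (kappa * (q%:R ^+ 2 * (x == x')%:R - q%:R)) <=
  q%:R ^+ 2 * (1 + 2 * q%:R ^+ 2 * (q%:R - 1) * kappa ^+ 2).
Proof.
move=> q0 k0 kq.
have q1 : 1 <= q%:R :> R by rewrite ler1n.
apply: (@le_trans _ _ (\sum_(x <- iota 0 q) \sum_(x' <- iota 0 q)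
   ((1 - kappa * q%:R + 2 * (kappa * q%:R) ^+ 2) + (x' == x)%:R *
     (kappa * q%:R ^+ 2 + 2 * ((kappa * (q%:R ^+ 2 - q%:R)) ^+ 2 - (kappa * q%:R) ^+ 2))))).
  apply: ler_sum => x _; apply: ler_sum => x' _; rewrite eq_sym.
  case: (x' == x) => /=.
    apply: (le_trans (expR_le _)); first by rewrite mulr1.
    by rewrite le_eqVlt; apply/orP; left; apply/eqP; ring.
  apply: (le_trans (expR_le _)).
    rewrite mulr0 sub0r mulrN; have : 0 <= kappa * q%:R by rewrite mulr_ge0.
    lra.
  by rewrite le_eqVlt; apply/orP; left; apply/eqP; ring.
rewrite big_seq.
under eq_bigr => x.
  rewrite mem_iota add0n => /andP[_ xq].
  rewrite big_split /= sum_iota_const (sum_pick (fun=> _) xq).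
  over.
rewrite -big_seq sum_iota_const le_eqVlt; apply/orP; left; apply/eqP; ring.
Qed.

Lemma second_moment_bound n m eps (A : seq bool -> R) q K th :
  (0 < n)%N -> (0 < q)%N ->
  is_tester [set @unif R (2 * n)]
    (@far_from_unif R (2 * n) eps `&` @unif_on_evens R (2 * n)) (51 / 100) m A ->
  0 <= th <= 1 -> (K * q <= n)%N ->
  eps * (2 * n)%:R < K%:R * (th * (q%:R - 1)) ->
  let kappa := m%:R * th ^+ 2 / (2 * n)%:R in
  kappa * (q%:R ^+ 2 - q%:R) <= 1 / 2 ->
  1 / (50 * 100) <= K%:R * (2 * q%:R ^+ 2 * (q%:R - 1) * kappa ^+ 2).
Proof.
move=> n0 q0 tester th01 Kqn heps kappa kq.
have N0 : 0 < (2 * n)%:R :> R by rewrite ltr0n muln_gt0.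
have q1 : 1 <= q%:R :> R by rewrite ler1n.
have k0 : 0 <= kappa by rewrite divr_ge0 // mulr_ge0 // sqr_ge0.
set C := 2 * q%:R ^+ 2 * (q%:R - 1) * kappa ^+ 2.
have C0 : 0 <= C by rewrite mulr_ge0 ?sqr_ge0 // !mulr_ge0 ?exprn_ge0 ?subr_ge0.
(* Otherwise K C is small enough for [pow_1D_le], and the final inequality 1/50 <= 1/100 + 50 K C is
   violated. *)
have [//|small] := lerP (1 / (50 * 100)) (K%:R * C).
pose Z := lists K (iota 0 q); pose D : R := q%:R ^+ K.
have D0 : 0 < D by rewrite exprn_gt0 // ltr0n.
pose N := (2 * n)%N; pose ts := lists m (iota 0 N).
(* L t / D is the likelihood ratio of t averaged over the D choices of heavy positions. *)
pose L (t : seq nat) := \sum_(z <- Z) \prod_(x <- t) weight q th z x.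
have sumZ (c : R) : \sum_(z <- Z) c = D * c by rewrite sum_lists_const size_iota.
have zP z : z \in Z -> size z = K /\ {in z, forall x, (x < q)%N}.
  move=> zZ; split; first exact: size_lists zZ.
  by move=> x /(mem_lists zZ); rewrite mem_iota.
have [A01 _ _] := tester.
have gap : D * (1 / 50 * N%:R ^+ m) <= \sum_(t <- ts) (D - L t) * A (trace_of t).
  rewrite -sumZ; apply: (@le_trans _ _ (\sum_(z <- Z)
    (sample_sum N m (fun=> 1) A - sample_sum N m (weight q th z) A))).
    rewrite big_seq [leRHS]big_seq; apply: ler_sum => z /zP[sz hz].
    by apply: tester_gap tester _ _ _ _; rewrite ?sz.
  rewrite sumrB sumZ /sample_sum exchange_big mulr_sumr -sumrB /=.
  apply: ler_sum => t _; rewrite -mulr_suml mulrBl big1_eq mul1r.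
  by [].
(* The term D / 100 uses up half of the gap 1/50. *)
have amgm t : (D - L t) * A (trace_of t) <=
    D / 100 + 25 / D * (D - L t) ^+ 2.
  have /andP[a0 a1] := A01 (trace_of t).
  have d0 : 0 < D / 10 by rewrite divr_gt0.
  apply: (@le_trans _ _ `|D - L t|).
    apply: le_trans (ler_norm _) _; rewrite normrM (ger0_norm a0).
    by rewrite ler_piMr.
  rewrite -(@real_normK _ (D - L t)) ?num_real //; set y := `|_|.
  rewrite -subr_ge0 (_ : _ - y = (D / 10 - 5 * y) ^+ 2 / D); last first.
    by field; rewrite gt_eqF.
  by rewrite divr_ge0 ?sqr_ge0 // ltW.
have sum1 : \sum_(t <- ts) (1 : R) = N%:R ^+ m.
  by rewrite sum_lists_const size_iota mulr1.
have sumL : \sum_(t <- ts) L t = D * N%:R ^+ m.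
  rewrite exchange_big /= -sumZ big_seq [RHS]big_seq; apply: eq_bigr => z /zP[sz hz].
  by rewrite sum_lists_prod sum_weight ?sz.
(* For two choices z, z' the sum over samples is the m-th power of an inner product. Using 1 + x <=
   exp x makes it a product over blocks, so that the sum over pairs factors too. *)
have sumL2 : \sum_(t <- ts) L t ^+ 2 <= N%:R ^+ m * (D ^+ 2 * (1 + 2 * (K%:R * C))).
  have -> : \sum_(t <- ts) L t ^+ 2 = \sum_(z <- Z) \sum_(z' <- Z)
      (\sum_(x <- iota 0 N) weight q th z x * weight q th z' x) ^+ m.
    under eq_bigr => t _ do rewrite expr2 mulr_suml.
    rewrite exchange_big; apply: eq_bigr => z _.
    under eq_bigr => t _ do rewrite mulr_sumr.
    rewrite exchange_big; apply: eq_bigr => z' _.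
    rewrite -sum_lists_prod; apply: eq_bigr => t _.
    by rewrite big_split.
  apply: (@le_trans _ _ (\sum_(z <- Z) \sum_(z' <- Z) N%:R ^+ m *
    \prod_(p <- zip z z') expR (kappa * (q%:R ^+ 2 * (p.1 == p.2)%:R - q%:R)))).
    rewrite big_seq [leRHS]big_seq; apply: ler_sum => z /zP[sz hz].
    rewrite big_seq [leRHS]big_seq; apply: ler_sum => z' /zP[sz' hz'].
    have I0 : 0 <= \sum_(x <- iota 0 N) weight q th z x * weight q th z' x.
      by apply: sumr_ge0 => x _; rewrite mulr_ge0 ?weight_ge0.
    rewrite sum_weight_mul ?sz ?sz' // in I0 *.
    rewrite -mulr_sumr in I0 *; set s := \sum_(p <- _) _ in I0 *.
    have -> : \prod_(p <- zip z z') expR (kappa * (q%:R ^+ 2 * (p.1 == p.2)%:R - q%:R))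
        = expR (th ^+ 2 * s / N%:R) ^+ m.
      rewrite -expRM_natl (_ : m%:R * _ = kappa * s); last first.
        by rewrite /kappa /N; field; rewrite ?pnatr_eq0 -?lt0n.
      by rewrite /s mulr_sumr expR_sum.
    rewrite -exprMn lerXn2r ?nnegrE // ?mulr_ge0 ?expR_ge0 //.
    rewrite (_ : N%:R + _ = N%:R * (1 + th ^+ 2 * s / N%:R)).
      by rewrite ler_pM2l // expR_ge1Dx.
    by rewrite /N; field; rewrite ?pnatr_eq0 -?lt0n.
  under eq_bigr do rewrite -mulr_sumr.
  rewrite -mulr_sumr sum_pairs_prod ler_wpM2l ?exprn_ge0 //.
  apply: (@le_trans _ _ ((q%:R ^+ 2 * (1 + C)) ^+ K)).
    rewrite lerXn2r ?nnegrE //.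
    + by do 2![apply: sumr_ge0 => ? _]; exact: expR_ge0.
    + by rewrite mulr_ge0 ?sqr_ge0 // addr_ge0.
    + exact: sum_pairs_expR.
  rewrite exprMn -exprM mulnC exprM -/D ler_wpM2l ?sqr_ge0 //.
  by apply: pow_1D_le => //; lra.
have : D * (1 / 50 * N%:R ^+ m) <= D / 100 * N%:R ^+ m + 25 / D *
    (N%:R ^+ m * (D ^+ 2 * (1 + 2 * (K%:R * C))) - D ^+ 2 * N%:R ^+ m).
  apply: le_trans gap _; apply: (@le_trans _ _ (\sum_(t <- ts)
     (D / 100 * 1 + 25 / D * (L t ^+ 2 + (D ^+ 2 * 1 - 2 * D * L t))))).
    apply: ler_sum => t _; apply: le_trans (amgm t) _.
    by rewrite le_eqVlt; apply/orP; left; apply/eqP; ring.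
  rewrite big_split /= -!mulr_sumr big_split sumrB -!mulr_sumr /= sum1 sumL.
  rewrite lerD2l ler_wpM2l ?divr_ge0 ?(ltW D0) //.
  have := sumL2; lra.
have Nm0 : 0 < N%:R ^+ m :> R by rewrite exprn_gt0.
have -> : 25 / D * (N%:R ^+ m * (D ^+ 2 * (1 + 2 * (K%:R * C))) - D ^+ 2 * N%:R ^+ m)
  = D * N%:R ^+ m * (50 * (K%:R * C)) by field; rewrite gt_eqF.
have -> : D * (1 / 50 * N%:R ^+ m) = D * N%:R ^+ m * (1 / 50) by ring.
have -> : D / 100 * N%:R ^+ m = D * N%:R ^+ m * (1 / 100) by field.
rewrite -mulrDr ler_pM2l ?mulr_gt0 //; lra.
Qed.

(** Independent heavy positions: averaging a product of blocks gives the product of the averages. *)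
Lemma sum_ps_weights th K (tail : seq R) w :
  \sum_(z <- lists K (iota 0 3)) ps true (weights 3 th z ++ tail) w =
  3 ^+ K * iter K (conv (mixed_block th)) (ps true tail) w.
Proof.
elim: K w => [|K IH] w; first by rewrite big_lists0 mul1r.
rewrite big_listsS iterS.
have -> : \sum_(x <- iota 0 3) \sum_(z <- lists K (iota 0 3))
    ps true (weights 3 th (x :: z) ++ tail) w =
  \sum_(x <- iota 0 3) conv (one_block th x) (fun u =>
     \sum_(z <- lists K (iota 0 3)) ps true (weights 3 th z ++ tail) u) w.
  apply: eq_bigr => x _; rewrite conv_sumr; apply: eq_bigr => z _.
  have -> : weights 3 th (x :: z) = interleave (block 3 th x) ++ weights 3 th z.
    exact: interleave_cat.
  by rewrite -catA ps_cat size_interleave odd_double.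
rewrite (eq_bigr (fun x => 3 ^+ K * conv (one_block th x)
   (iter K (conv (mixed_block th)) (ps true tail)) w)); last first.
  by move=> x _; rewrite -convZr; apply: eq_conv => // u; exact: IH.
rewrite -mulr_sumr -conv_suml /mixed_block convZl exprS.
by field.
Qed.

Lemma ps_ones K (tail : seq R) w :
  ps true (nseq (6 * K) 1 ++ tail) w = iter K (conv (base_block R)) (ps true tail) w.
Proof.
elim: K w => [|K IH] w; first by rewrite muln0.
rewrite mulnS nseqD -catA ps_cat iterS.
by apply: eq_conv => // u; exact: IH.
Qed.

Lemma map_const_iota (T : Type) (c : T) i k : [seq c | _ <- iota i k] = nseq k c.
Proof. by elim: k i => //= k IH i; rewrite IH. Qed.

Lemma trace_bound n m eps (A : seq bool -> R) B J th :
  (0 < n)%N -> (0 < B)%N ->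
  is_tester [set @unif R (2 * n)]
    (@far_from_unif R (2 * n) eps `&` @unif_on_evens R (2 * n)) (51 / 100) m A ->
  0 <= th <= 1 -> (J * B * 3 <= n)%N ->
  eps * (2 * n)%:R < (J * B)%:R * (th * (3%:R - 1)) ->
  899 * 6 * (m%:R * B%:R) <= n%:R :> R ->
  B%:R ^+ 4 <= 100 ^+ 2 * (J%:R * th ^+ 4).
Proof.
move=> n0 B0 tester th01 JBn heps mBn.
have N0 : 0 < (2 * n)%:R :> R by rewrite ltr0n muln_gt0.
have Bp : 0 < B%:R :> R by rewrite ltr0n.
have [A01 _ _] := tester.
pose N := (2 * n)%N; pose K := (J * B)%N; pose Z := lists K (iota 0 3).
pose r := (N - 6 * K)%N; pose tail : seq R := nseq r 1.
pose U := ps true tail.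
pose S := iter B (conv (base_block R)) (ser1 R).
pose T := iter B (conv (mixed_block th)) (ser1 R).
have KN : (6 * K <= N)%N by rewrite /K /N; lia.
have zP z : z \in Z -> size z = K /\ {in z, forall x, (x < 3)%N}.
  move=> zZ; split; first exact: size_lists zZ.
  by move=> x /(mem_lists zZ); rewrite mem_iota.
have null : sample_sum N m (fun=> 1) A =
    m`!%:R * \sum_(w <- words m) iter J (conv S) U w * A w.
  rewrite /sample_sum (lists_trace_ps (fun=> 1)); congr (_ * _).
  apply: eq_bigr => w _; congr (_ * _).
  rewrite -iter_conv_mul -ps_ones -nseqD subnKC //.
  by rewrite map_const_iota.
have alt : \sum_(z <- Z) sample_sum N m (weight 3 th z) A =
    3 ^+ K * (m`!%:R * \sum_(w <- words m) iter J (conv T) U w * A w).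
  rewrite mulrCA mulr_sumr.
  transitivity (\sum_(z <- Z) m`!%:R * \sum_(w <- words m)
      ps true (weights 3 th z ++ tail) w * A w).
    rewrite big_seq [RHS]big_seq; apply: eq_bigr => z /zP[sz _].
    rewrite /sample_sum (lists_trace_ps (weight 3 th z)) map_nth_pad.
      by rewrite size_weights sz /tail /r mulnA mulnC mulnA.
    by rewrite size_weights sz; lia.
  rewrite -mulr_sumr exchange_big; congr (_ * _); apply: eq_bigr => w _ /=.
  by rewrite -mulr_suml sum_ps_weights iter_conv_mul mulrA.
have gap : 1 / 50 * N%:R ^+ m <= m`!%:R * \sum_(w <- words m)
    (iter J (conv S) U w - iter J (conv T) U w) * A w.
  have p3 : 0 < 3 ^+ K :> R by rewrite exprn_gt0.
  rewrite -(ler_pM2l p3); apply: (@le_trans _ _ (\sum_(z <- Z)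
    (sample_sum N m (fun=> 1) A - sample_sum N m (weight 3 th z) A))).
    rewrite (_ : 3 ^+ K * _ = \sum_(z <- Z) (1 / 50 * N%:R ^+ m)); last first.
      by rewrite sum_lists_const size_iota.
    rewrite big_seq [leRHS]big_seq; apply: ler_sum => z /zP[sz hz].
    by apply: tester_gap tester _ _ _ _; rewrite ?sz.
  rewrite sumrB alt sum_lists_const null -mulrBr size_iota -mulrBr -sumrB.
  by under [X in _ <= _ * (_ * X)]eq_bigr do rewrite mulrBl.
have massU : has_mass U (r%:R : R).
  have := has_mass_ps true tail.
  by rewrite /tail big_nseq iter_addr_0.
have massS : has_mass S (6 * B%:R).
  have := has_mass_iter B (has_mass_base_block R) (has_mass_ser1 R).
  by rewrite addr0 mulrC.
have massT : has_mass T (6 * B%:R).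
  have := has_mass_iter B (has_mass_mixed_block th) (has_mass_ser1 R).
  by rewrite addr0 mulrC.
have s0 w : 0 <= ser1 R w by rewrite ler0n.
have S0 w : 0 <= S w by apply: iter_conv_ge0 => // u; exact: base_block_ge0.
have T0 w : 0 <= T w by apply: iter_conv_ge0 => // u; exact: mixed_block_ge0.
have U0 w : 0 <= U w by apply: ps_ge0 => a /nseqP[->].
(* The bound of [superblock_close]; its square gives c = 30^2 = 900, whence 899 = c - 1 in the
   hypothesis on m B. *)
pose eta k := th ^+ 2 / B%:R ^+ 2 * 30 ^+ k.
pose kappa := th ^+ 4 / B%:R ^+ 4.
have etaP k : eta k ^+ 2 <= kappa * 900 ^+ k.
  rewrite /eta /kappa (_ : 900 = 30 ^+ 2); last by rewrite expr2; lra.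
  by rewrite -exprM mulnC exprM le_eqVlt; apply/orP; left; apply/eqP; field; rewrite gt_eqF.
have sig0 : 0 <= 6 * B%:R :> R by rewrite mulr_ge0.
have close w : `|T w - S w| <= eta (size w) * S w by exact: superblock_close.
(* With t = 1/100, half of the gap 1/50 is left for the chi-square term. *)
have t0 : 0 < 1 / 100 :> R by lra.
have t4 : 1 / 100 <= 1 / 4 :> R by lra.
have := iter_conv_gap S0 T0 U0 sig0 (ler0n R r) massS massT massU
  close etaP J m A01 t0 t4.
have f0 : 0 < m`!%:R :> R by rewrite ltr0n fact_gt0.
have -> : J%:R * (6 * B%:R) + r%:R = N%:R :> R.
  by rewrite /r natrB // /K !natrM; ring.
move=> h; rewrite -(ler_pM2l f0) in h; have {h} := le_trans gap h.
set y := N%:R + _; set P := N%:R ^+ m.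
have -> : m`!%:R * (1 / 100 * (P / m`!%:R) + J%:R * kappa * (y ^+ m / m`!%:R) / (2 * (1 / 100)))
  = 1 / 100 * P + 50 * (J%:R * kappa) * y ^+ m by field; rewrite gt_eqF.
have P0 : 0 < P by rewrite exprn_gt0.
(* The bound on m B makes the exponential moment of the lengths cost only a factor 2. *)
have yP : y ^+ m <= P * 2.
  have -> : y = N%:R * (1 + 899 * 6 * B%:R / N%:R).
    by rewrite /y; field; rewrite gt_eqF.
  rewrite exprMn ler_wpM2l ?(ltW P0) //.
  have mx : m%:R * (899 * 6 * B%:R / N%:R) <= 1 / 2 :> R.
    rewrite mulrA ler_pdivrMr // /N natrM; lra.
  apply: le_trans (pow_1D_le _ mx) _; last lra.
  by rewrite divr_ge0 ?mulr_ge0 // ltW.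
have kap0 : 0 <= J%:R * kappa.
  by rewrite mulr_ge0 // divr_ge0 ?exprn_ge0 //; case/andP: th01.
have : J%:R * kappa * y ^+ m <= J%:R * kappa * (P * 2) by rewrite ler_wpM2l.
move=> h1 h2; have : 1 * P <= (100 ^+ 2 * (J%:R * kappa)) * P by lra.
rewrite ler_pM2r // /kappa => h.
have {}h : 1 <= 100 ^+ 2 * (J%:R * th ^+ 4) / B%:R ^+ 4 by rewrite -2!mulrA.
by move: h; rewrite ler_pdivlMr ?exprn_gt0 // mul1r.
Qed.

End Bounds.

(** * Choice of parameters for the two bounds *)

Section SampleComplexity.

Variable R : realType.

Lemma amplitude (eps : R) : 0 < eps -> eps < 1 / 4 ->
  exists th : R, [/\ 0 <= th <= 1, 4 * eps < th & th <= 8 * eps].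
Proof.
(* The witness is 1 - (1 - 4 eps)^2, which never exceeds 1; the factor 2 - 4 eps lies between 1 and
   2. *)
move=> e0 e4; exists (4 * eps * (2 - 4 * eps)).
have h : 0 <= (1 - 4 * eps) ^+ 2 by exact: sqr_ge0.
have h1 : 0 < 4 * eps * (1 - 4 * eps) by rewrite !mulr_gt0 //; lra.
have h2 : 0 < eps * eps by rewrite mulr_gt0.
by move: h; rewrite expr2 => h; split; [apply/andP; split| |]; lra.
Qed.

Lemma sqrt_over_sqr_le n m (eps : R) (A : seq bool -> R) :
  (2 <= n)%N -> 0 < eps -> eps < 1 / 4 ->
  is_tester [set @unif R (2 * n)]
    (@far_from_unif R (2 * n) eps `&` @unif_on_evens R (2 * n)) (51 / 100) m A ->
  Num.sqrt n%:R / eps ^+ 2 <= 200 ^+ 2 * m%:R.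
Proof.
move=> n2 e0 e4 tester; have [th [th01 th4 th8]] := amplitude e0 e4.
have n0 : (0 < n)%N by lia.
have np : 0 < n%:R :> R by rewrite ltr0n.
(* A single block of all odd elements for n < 6, blocks of three otherwise. *)
have [q [K [q2 q5 Kqn Kq2]]] : exists q K, [/\ (2 <= q)%N, (q <= 5)%N,
    (K * q <= n)%N & (n <= 2 * K * (q - 1))%N].
  have [n6|n6] := ltnP n 6; first by exists n, 1%N; split; lia.
  by exists 3%N, (n %/ 3)%N; split; lia.
have q0 : (0 < q)%N by lia.
have q2R : 2 <= q%:R :> R by rewrite ler_nat.
have q5R : q%:R <= 5 :> R by rewrite ler_nat.
have KqnR : K%:R * q%:R <= n%:R :> R by rewrite -natrM ler_nat.
have Kq2R : n%:R <= 2 * (K%:R * (q%:R - 1)) :> R.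
  by rewrite mulrA -natrM -(natrB _ q0) -natrM ler_nat.
have heps : eps * (2 * n)%:R < K%:R * (th * (q%:R - 1)).
  rewrite natrM; apply: (@lt_le_trans _ _ (th / 2 * n%:R)).
    by rewrite mulrA ltr_pM2r //; lra.
  rewrite mulrCA -mulrA ler_wpM2l //; first by case/andP: th01.
  lra.
pose kappa : R := m%:R * th ^+ 2 / (2 * n)%:R.
have main : kappa * (q%:R ^+ 2 - q%:R) <= 1 / 2 ->
    1 / (50 * 100) <= K%:R * (2 * q%:R ^+ 2 * (q%:R - 1) * kappa ^+ 2).
  exact: second_moment_bound n0 q0 tester th01 Kqn heps.
have k0 : 0 <= kappa by rewrite divr_ge0 // mulr_ge0 // sqr_ge0.
have qq0 : 0 <= q%:R * (q%:R - 1) :> R by rewrite mulr_ge0 // subr_ge0; lra.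
have qq : q%:R * (q%:R - 1) <= 5 * 4 :> R by rewrite ler_pM // ?subr_ge0; lra.
have lower : n%:R <= (200 * 1000) * (n%:R * kappa) ^+ 2.
  have : 1 <= (200 * 1000) * (n%:R * kappa ^+ 2).
    (* If the second moment bound does not apply, then kappa >= 1/40 because q^2 - q <= 20, which is
       even stronger. *)
    have [kq|h] := lerP (kappa * (q%:R ^+ 2 - q%:R)) (1 / 2).
      have h := main kq; clear main.
      have b : K%:R * (2 * q%:R ^+ 2 * (q%:R - 1) * kappa ^+ 2) <=
          n%:R * (2 * (5 * 4)) * kappa ^+ 2.
        rewrite [leLHS](_ : _ = K%:R * q%:R * (2 * (q%:R * (q%:R - 1))) * kappa ^+ 2);
          last by ring.
        rewrite ler_wpM2r ?sqr_ge0 //.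
        by apply: ler_pM => //; [exact: mulr_ge0|exact: mulr_ge0|lra].
      lra.
    have : kappa * (q%:R ^+ 2 - q%:R) <= kappa * (5 * 4).
      by rewrite ler_wpM2l // (_ : _ - _ = q%:R * (q%:R - 1)); last by ring.
    move=> h'; have k40 : 1 / 40 <= kappa by lra.
    have k2 : 1 / 40 * (1 / 40) <= kappa ^+ 2 by rewrite expr2 ler_pM //; lra.
    have : 1 * (1 / 40 * (1 / 40)) <= n%:R * kappa ^+ 2.
      by rewrite ler_pM // ?ler1n //; lra.
    lra.
  move=> h; rewrite [leRHS](_ : _ = n%:R * (200 * 1000 * (n%:R * kappa ^+ 2))).
    by rewrite -[leLHS]mulr1 ler_pM2l.
  by ring.
have nk : n%:R * kappa = m%:R * th ^+ 2 / 2.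
  by rewrite /kappa natrM; field; rewrite ?pnatr_eq0 -?lt0n.
have me0 : 0 <= m%:R * eps ^+ 2 by rewrite mulr_ge0 // sqr_ge0.
have nk32 : n%:R * kappa <= 32 * (m%:R * eps ^+ 2).
  rewrite nk; have : m%:R * th ^+ 2 <= m%:R * (8 * eps) ^+ 2.
    rewrite ler_wpM2l // lerXn2r ?nnegrE //; [by case/andP: th01|lra].
  by rewrite exprMn; lra.
rewrite ler_pdivrMr ?exprn_gt0 // -mulrA.
(* 500^2 exceeds 200 * 1000, and 500 * 32 is below 200^2. *)
apply: (@le_trans _ _ (500 * (n%:R * kappa))); last first.
  have c0 : 500 * 32 <= 200 ^+ 2 :> R by rewrite expr2; lra.
  apply: le_trans (ler_wpM2r me0 c0); rewrite -mulrA; lra.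
have r0 : 0 <= 500 * (n%:R * kappa) by rewrite mulr_ge0 // mulr_ge0.
rewrite -(ger0_norm r0) -sqrtr_sqr ler_wsqrtr //.
by apply: le_trans lower _; rewrite [leRHS]exprMn ler_wpM2r ?sqr_ge0 // expr2; lra.
Qed.

(** Fewer than 3 B <= n / 4 odd elements stay outside the superblocks. *)
Lemma superblock_count B n : (0 < B)%N -> (12 * B <= n)%N ->
  [/\ n %/ (3 * B) * B * 3 <= n, n <= 4 * (n %/ (3 * B) * B) & 0 < n %/ (3 * B) * B]%N.
Proof.
move=> B0 Bn; have B3 : (0 < 3 * B)%N by rewrite muln_gt0.
have := ltn_ceil n B3; have := leq_divM n (3 * B).
rewrite (mulSn (_ %/ _)) (mulnCA _ 3).
move: (n %/ (3 * B) * B)%N => k; move: B0 Bn {B3}; clear; split; lia.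
Qed.

Lemma four_fifths_le n m (eps y : R) (A : seq bool -> R) :
  (2 <= n)%N -> 0 < eps -> eps < 1 / 4 ->
  is_tester [set @unif R (2 * n)]
    (@far_from_unif R (2 * n) eps `&` @unif_on_evens R (2 * n)) (51 / 100) m A ->
  1 <= y -> y ^+ 5 = n%:R * eps ^+ 4 ->
  n%:R <= 12 * 31 * y \/ n%:R <= 899 * 6 * 31 * m%:R * y.
Proof.
move=> n2 e0 e4 tester y1 y5; have [th [th01 th4 th8]] := amplitude e0 e4.
have n0 : (0 < n)%N by lia.
have np : 0 < n%:R :> R by rewrite ltr0n.
(* B lies above 30 y, and 3 * 30^5 > 100^2 * 8^4 then contradicts [trace_bound]; so its hypothesis
   on m B must fail. As y >= 1, B is at most 31 y. *)
pose B := (Num.truncn (30 * y)).+1.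
have y30 : 0 <= 30 * y by lra.
have /andP[Bl Bu] := Num.Theory.truncn_itv y30.
rewrite -/B in Bu.
have B31 : B%:R <= 31 * y by rewrite /B -natr1; lra.
have [nB|Bn] := ltnP n (12 * B).
  left; apply: (@le_trans _ _ (12 * B)%:R); first by rewrite ler_nat ltnW.
  by rewrite natrM; lra.
right; pose J := (n %/ (3 * B))%N.
have [JB3 JB4 JB0] := superblock_count (isT : (0 < B)%N) Bn.
rewrite -/J in JB3 JB4 JB0.
have JB4R : n%:R <= 4 * (J * B)%:R :> R by rewrite -natrM ler_nat.
have heps : eps * (2 * n)%:R < (J * B)%:R * (th * (3%:R - 1)).
  have h1 : 4 * eps * (J * B)%:R < th * (J * B)%:R.
    by rewrite ltr_pM2r // ltr0n.
  have h2 : eps * n%:R <= eps * (4 * (J * B)%:R) by rewrite ler_wpM2l // ltW.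
  by rewrite natrM; lra.
have [mB|mB] := lerP (899 * 6 * (m%:R * B%:R)) (n%:R : R); last first.
  apply: le_trans (ltW mB) _; rewrite -!mulrA !ler_wpM2l // mulrCA ler_wpM2l //.
have := trace_bound n0 (isT : (0 < B)%N) tester th01 JB3 heps mB => h.
have Bp : 0 < B%:R :> R by rewrite ltr0n.
(* Multiplication by 3 B turns J into 3 J B <= n. *)
have : 3 * B%:R ^+ 5 <= 100 ^+ 2 * (n%:R * (8 * eps) ^+ 4).
  rewrite exprS; apply: (@le_trans _ _ (3 * (B%:R * (100 ^+ 2 * (J%:R * th ^+ 4))))).
    by rewrite ler_wpM2l // ler_wpM2l // ltW.
  rewrite (_ : 3 * _ = 100 ^+ 2 * ((J * B * 3)%:R * th ^+ 4)); last first.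
    by rewrite !natrM; ring.
  rewrite ler_wpM2l ?exprn_ge0 // ler_pM ?exprn_ge0 ?ler_nat //.
    by case/andP: th01.
  by rewrite lerXn2r ?nnegrE //; [case/andP: th01|lra].
have : (30 * y) ^+ 5 < B%:R ^+ 5 by rewrite ltrXn2r // ltW.
have : 0 < y ^+ 5 by rewrite exprn_gt0 //; lra.
rewrite !exprMn [n%:R * _]mulrCA -y5; lra.
Qed.

End SampleComplexity.

(** * Combination of the two bounds *)

Theorem theorem5p1 (R : realType) :
  exists (c : R) (k : nat), 0 < c /\
    forall (n : nat) (eps : R) (m : nat) (A : seq bool -> R),
      (2 <= n)%N -> 0 < eps -> eps < 1 / 4 ->
      let bound :=
        c * ((n%:R / eps) `^ (4 / 5) + Num.sqrt n%:R / eps ^+ 2) / ln n%:R ^+ k in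
      (is_tester [set @unif R (2 * n)] (@far_from_unif R (2 * n) eps)
                 (51 / 100) m A ->
       bound <= m%:R) /\
      (is_tester [set @unif R (2 * n)]
                 (@far_from_unif R (2 * n) eps `&` @unif_on_evens R (2 * n))
                 (51 / 100) m A ->
       bound <= m%:R).
Proof.
(* No logarithm is lost. The constant is dictated by the case X <= 12 * 31, where X is compared with
   P using 1 <= P <= 200^2 m. *)
exists (2 * 200 ^+ 3)^-1, 0%N; split; first by rewrite invr_gt0 mulr_gt0 ?exprn_gt0.
move=> n eps m A n2 e0 e4 bound.
(* A tester for all far distributions is also one for those uniform on the evens. *)
suff main : is_tester [set @unif R (2 * n)]
    (@far_from_unif R (2 * n) eps `&` @unif_on_evens R (2 * n)) (51 / 100) m A ->
    bound <= m%:R.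
  split=> // -[A01 h1 h2]; apply: main; split=> // p [pfar _]; exact: h2.
move=> tester; rewrite /bound expr0 divr1.
have np : 0 < n%:R :> R by rewrite ltr0n; lia.
have sP := sqrt_over_sqr_le n2 e0 e4 tester.
set P := Num.sqrt _ / _ in sP *; set X := _ `^ _.
pose y := (n%:R * eps ^+ 4) `^ 5^-1.
have ne0 : 0 < n%:R * eps ^+ 4 by rewrite mulr_gt0 // exprn_gt0.
have y0 : 0 < y by exact: powR_gt0.
have y5 : y ^+ 5 = n%:R * eps ^+ 4.
  rewrite -powR_mulrn ?(ltW y0) // /y -powRrM mulVf ?powRr1 ?ltW //.
  by rewrite pnatr_eq0.
have Xy : X * y = n%:R.
  have ne : 0 <= n%:R / eps by rewrite divr_ge0 // ltW.
  rewrite /X /y powRrM powR_mulrn // -powRM ?exprn_ge0 ?(ltW ne0) //.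
  have -> : (n%:R / eps) ^+ 4 * (n%:R * eps ^+ 4) = n%:R ^+ 5.
    by field; rewrite gt_eqF.
  by rewrite -powR_mulrn // -powRrM mulfV ?powRr1 // pnatr_eq0.
have s1 : 1 <= Num.sqrt n%:R :> R.
  by rewrite -[leLHS]sqrtr1 ler_wsqrtr // ler1n; lia.
have e1 : eps ^+ 2 <= 1 by rewrite expr_le1 // ltW //; lra.
have P1 : 1 <= P.
  rewrite /P ler_pdivlMr ?exprn_gt0 // mul1r; lra.
have m0 : 0 <= m%:R :> R by [].
rewrite mulrC ler_pdivrMr ?mulr_gt0 ?exprn_gt0 //.
have [y1|y1] := lerP y 1.
  (* For y <= 1 the first term is dominated: sqrt n * eps^2 is y^(5/2) <= y, and X = n / y. *)
  have XP : X <= P.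
    rewrite -(ler_pM2r y0) Xy /P mulrAC ler_pdivlMr ?exprn_gt0 //.
    rewrite -[X in X * _ <= _](sqr_sqrtr (ltW np)) expr2 -mulrA ler_wpM2l ?sqrtr_ge0 //.
    have h : (Num.sqrt n%:R * eps ^+ 2) ^+ 2 <= y ^+ 2.
      rewrite exprMn sqr_sqrtr ?(ltW np) // -exprM -y5.
      by rewrite ler_wiXn2l // ltW.
    by rewrite -(@ler_pXn2r _ 2) // ?nnegrE ?mulr_ge0 ?sqrtr_ge0 ?sqr_ge0 // ltW.
  lra.
have [h|h] := four_fifths_le n2 e0 e4 tester (ltW y1) y5.
  have : X <= 12 * 31 by rewrite -(ler_pM2r y0) Xy.
  lra.
have : X <= 899 * 6 * 31 * m%:R by rewrite -(ler_pM2r y0) Xy.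
lra.
Qed.
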